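(* D-APEP$\langle\mathsf{BoD_E},\mathsf{SoD_U}\rangle$ can be solved in time $O^*\left(2^{k^2\log k^2}\right)$, where $k=|R|$ is the number of resources.
   Context: D-APEP. An instance consists of a finite set $U$ of users, a finite set $R$ of resources, a base authorization relation $A_{\sf Bse}\subseteq U\times R$ with $A_{\sf Bse}(r)\neq\emptyset$ for all $r\in R$, and a set $C$ of constraints. For $A\subseteq U\times R$, $A(r)=\{u\in U:(u,r)\in A\}$. $A$ is authorized if $A\subseteq A_{\sf Bse}$, complete if $A(r)\ne\emptyset$ for all $r\in R$, eligible if it satisfies every $c\in C$, and valid if it is authorized, complete and eligible. The problem is to decide whether a valid $A$ exists (and, if so, find one). For $r,r'\in R$ and complete $A$: a $\mathsf{BoD_E}$ constraint $(r,r',\leftrightarrow,\exists)$ is satisfied iff $A(r)\cap A(r')\neq\emptyset$; a $\mathsf{SoD_U}$ constraint $(r,r',\updownarrow,\forall)$ is satisfied iff $A(r)\cap A(r')=\emptyset$. D-APEP$\langle\mathsf{BoD_E},\mathsf{SoD_U}\rangle$ is the restriction to instances in which all constraints are $\mathsf{BoD_E}$ or $\mathsf{SoD_U}$ constraints. $O^*$ suppresses factors polynomial in the input size as well as multiplicative constants. Logarithms are base 2. *)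

(* Defs.v *)
From HB Require Import structures.
From mathcomp Require Import all_boot all_order all_algebra.
From mathcomp Require Import reals exp.

Set Implicit Arguments.
Unset Strict Implicit.
Unset Printing Implicit Defensive.

Import Order.TTheory GRing.Theory Num.Theory.

(* [BoD_E r r'] is (r, r', <->, exists) and [SoD_U r r'] is
   (r, r', not <->, forall); [r = r'] is allowed. *)
Inductive constr (R : Type) : Type :=
  | BoD_E of R & R
  | SoD_U of R & R.

Definition constr_to_sum (R : Type) (c : constr R) : R * R + R * R :=
  match c with BoD_E r r' => inl (r, r') | SoD_U r r' => inr (r, r') end.

Definition constr_of_sum (R : Type) (s : R * R + R * R) : constr R :=
  match s with inl p => BoD_E p.1 p.2 | inr p => SoD_U p.1 p.2 end.

Lemma constr_to_sumK (R : Type) :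
  cancel (@constr_to_sum R) (@constr_of_sum R).
Proof. by case. Qed.

HB.instance Definition _ (R : eqType) :=
  Equality.copy (constr R) (can_type (@constr_to_sumK R)).
HB.instance Definition _ (R : choiceType) :=
  Choice.copy (constr R) (can_type (@constr_to_sumK R)).
HB.instance Definition _ (R : countType) :=
  Countable.copy (constr R) (can_type (@constr_to_sumK R)).
HB.instance Definition _ (R : finType) :=
  Finite.copy (constr R) (can_type (@constr_to_sumK R)).

Section Problem.

Variables U R : finType.

Implicit Types A : {set U * R}.

Definition users_of A (r : R) : {set U} := [set u | (u, r) \in A].

Record instance := Instance {
  base : {set U * R};
  constraints : {set constr R};
  base_neq0 : forall r, users_of base r != set0
}.

Definition satisfies A (c : constr R) : bool :=
  match c with
  | BoD_E r r' => users_of A r :&: users_of A r' != set0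
  | SoD_U r r' => users_of A r :&: users_of A r' == set0
  end.

Variable I : instance.

Definition authorized A : bool := A \subset base I.
Definition complete A : bool := [forall r, users_of A r != set0].
Definition eligible A : bool := [forall c in constraints I, satisfies A c].
Definition valid A : bool := [&& authorized A, complete A & eligible A].

(* A relation is written as the adjacency lists of the users, each list being
   preceded by its length.  The length of [encode_instance] is
   [3 + #|U| + #|base| + 3 * #|constraints|]; since every resource has a
   user in [base], every word of the encoding is at most that length, so the
   number of words and the number of bits of the input are polynomially
   related. *)
Definition encode_resources (S : {set R}) : seq nat :=
  #|S| :: [seq val (enum_rank r) | r <- enum S].

Definition encode_relation A : seq nat :=
  flatten [seq encode_resources [set r | (u, r) \in A] | u <- enum U].

Definition encode_constr (c : constr R) : seq nat :=
  match c with
  | BoD_E r r' => [:: 0; val (enum_rank r); val (enum_rank r')]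
  | SoD_U r r' => [:: 1; val (enum_rank r); val (enum_rank r')]
  end.

Definition encode_instance : seq nat :=
  [:: #|U|; #|R|; #|constraints I|]
    ++ encode_relation (base I)
    ++ flatten [seq encode_constr c | c <- enum (constraints I)].

Definition correct_answer (y : seq nat) : Prop :=
  (exists2 A, valid A & y = 1 :: encode_relation A)
  \/ (forall A, ~~ valid A) /\ y = [:: 0].

End Problem.

(* A RAM with a read-only input tape, a write-only output tape, and memory
   cells that hold natural numbers and are initially zero.  Time is the number
   of executed instructions.  Successor and predecessor are the only
   arithmetic instructions, so that after [t] steps no cell exceeds the
   largest word of the input or the program by more than [t]: unit cost and
   logarithmic cost differ by a factor logarithmic in [t] and the input. *)
Inductive instr : Type :=
  | ISet of nat & nat             (* m[x] := c *)
  | ICopy of nat & nat            (* m[x] := m[y] *)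
  | ISucc of nat                  (* m[x] := m[x] + 1 *)
  | IPred of nat                  (* m[x] := m[x] - 1, truncated at 0 *)
  | ILoad of nat & nat            (* m[x] := m[m[y]] *)
  | IStore of nat & nat           (* m[m[x]] := m[y] *)
  | IJeq of nat & nat & nat       (* if m[x] = m[y] goto l *)
  | IRead of nat                  (* m[x] := next input word, 0 at the end *)
  | IWrite of nat.                (* append m[x] to the output *)

Definition program := seq instr.

Record config := Config {
  pc : nat;
  mem : nat -> nat;
  input : seq nat;
  output : seq nat
}.

Definition assign (s : config) (a v : nat) : config :=
  Config (pc s).+1 [eta mem s with a |-> v] (input s) (output s).

Definition exec (i : instr) (s : config) : config :=
  let m := mem s in
  match i with
  | ISet x c => assign s x c
  | ICopy x y => assign s x (m y)
  | ISucc x => assign s x (m x).+1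
  | IPred x => assign s x (m x).-1
  | ILoad x y => assign s x (m (m y))
  | IStore x y => assign s (m x) (m y)
  | IJeq x y l =>
      Config (if m x == m y then l else (pc s).+1) m (input s) (output s)
  | IRead x =>
      Config (pc s).+1 [eta m with x |-> head 0 (input s)]
             (behead (input s)) (output s)
  | IWrite x =>
      Config (pc s).+1 m (input s) (rcons (output s) (m x))
  end.

Definition halted (P : program) (s : config) : bool := size P <= pc s.

Definition step (P : program) (s : config) : config :=
  if onth P (pc s) is Some i then exec i s else s.

Definition initial (x : seq nat) : config := Config 0 (fun=> 0) x [::].

(* Halted configurations are fixed by [step]: the machine halts on [x] with
   output [y] after at most [t] steps. *)
Definition computes_within (P : program) (x : seq nat) (t : nat) (y : seq nat)
    : Prop :=
  let s := iter t (step P) (initial x) in halted P s /\ output s = y.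

Local Open Scope ring_scope.

Definition log2 (K : realType) (x : K) : K := ln x / ln 2.

(* A single program solves every instance, finding a valid relation if there
   is one, in time [c * N ^ d * g k], where [N] is the input size and
   [k = #|R|].  As [N >= 3], the monomials [c * N ^ d] dominate all
   polynomials in [N]. *)
Definition solvable_in_time_Ostar (K : realType) (g : nat -> K) : Prop :=
  exists (P : program) (c d : nat),
  forall (U R : finType) (I : instance U R),
  exists (t : nat) (y : seq nat),
    [/\ computes_within P (encode_instance I) t y,
        correct_answer I y
      & t%:R <= c%:R * (size (encode_instance I))%:R ^+ d * g #|R|].

(* Main.v *)
Require Import Defs.
From mathcomp Require Import all_boot all_order all_algebra.
From mathcomp Require Import reals exp.
From mathcomp Require Import zify.

Set Implicit Arguments.
Unset Strict Implicit.
Unset Printing Implicit Defensive.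

Import Order.TTheory GRing.Theory Num.Theory.

(* Let [S u] be the set of resources given to the user [u].  Completeness is a
   constraint BoD_E [r r] for each resource [r], so there are [L = O(k^2)]
   constraints in all, and the users only interact through the set of BoD_E
   constraints that are already satisfied.  Dynamic programming over the users
   with this set ([2 ^ L] values) as the state, trying the [2 ^ k] values of
   [S u] and the [2 ^ L] next states for each user, takes time [2 ^ O(k^2)]
   times a polynomial.  This is within the bound: [2 ^ (D k^2)] is at most
   [(k^2) ^ (k^2)] unless [k^2 < 2 ^ D], which costs a constant factor.  Since
   any constant [D] is allowed, arithmetic may be done in unary and time may be
   bounded crudely, by a polynomial in the largest stored value. *)

(** * Fragments of machine code *)

(** The obstacle is the machine: one fixed program must be exhibited, with products, array addresses
    and tests all reduced to successor, predecessor and equality jumps. The algorithm is therefore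
    written in a small language whose only loop is a [For] with a number of rounds fixed on entry.
    Termination then comes for free, and so does the time bound: the nesting depth is fixed by the
    program, all stored values and numbers of rounds are at most some [B], and expression values are
    polynomial in [B]. What remains is functional correctness and the inequalities that keep stored
    values below [B]. The choice is [B = N * 2 ^ (3 * k ^ 2)] for input size [N]; the 3 covers the
    [k] completeness requirements and at most [2 * k ^ 2] constraints. SoD_U needs no state, because
    it forbids two resources to one and the same user, a condition on each [S u] separately. The
    table is kept for all final segments of the users, so that a relation can be written user by
    user by walking through it. *)

Record rstate := RState { rmem : nat -> nat; rin : seq nat; rout : seq nat }.

Definition config_at o (s : rstate) := Config o (rmem s) (rin s) (rout s).

(* A code fragment depends on the address at which it is placed. *)
Definition code := nat -> seq instr.

Definition code1 (i : instr) : code := fun=> [:: i].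
Definition code_seq (c1 c2 : code) : code :=
  fun o => c1 o ++ c2 (o + size (c1 o)).
(** The loop is left when the cells [a] and [b] agree; the closing jump compares [a] with itself and
    so is unconditional. *)
Definition code_while a b (c : code) : code := fun o =>
  IJeq a b (o + size (c o.+1)).+2 :: c o.+1 ++ [:: IJeq a a o].
Definition code_ifne a b (c : code) : code := fun o =>
  IJeq a b (o + size (c o.+1)).+1 :: c o.+1.

Declare Scope code_scope.
Delimit Scope code_scope with code.
Bind Scope code_scope with code.
Notation "c1 ;; c2" := (code_seq c1 c2)
  (at level 61, right associativity) : code_scope.

(** A total-correctness triple with a time bound. Quantifying over the surrounding code makes
    fragments composable: a part of a fragment again sits between some [pre] and some [post]. *)
Definition reach T (c : code) s (Q : rstate -> Prop) : Prop :=
  forall pre post, let P := pre ++ c (size pre) ++ post in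
  exists t s', [/\ t <= T,
    iter t (step P) (config_at (size pre) s)
      = config_at (size pre + size (c (size pre))) s'
    & Q s'].

Lemma onth_size_cat (pre post : program) i :
  onth (pre ++ i :: post) (size pre) = Some i.
Proof. by elim: pre => //= x p ->. Qed.

Lemma step_at pre i post (s : rstate) :
  step (pre ++ i :: post) (config_at (size pre) s)
  = exec i (config_at (size pre) s).
Proof. by rewrite /step /= onth_size_cat. Qed.

Lemma reach_weaken T T' c s (Q Q' : rstate -> Prop) :
  reach T c s Q -> T <= T' -> (forall s', Q s' -> Q' s') -> reach T' c s Q'.
Proof.
move=> H le_T QQ' pre post; have [t [s' [le_t run Qs']]] := H pre post.
by exists t, s'; split=> //; [apply: leq_trans le_T | apply: QQ'].
Qed.

Lemma reach_instr i s s' :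
  (forall o, exec i (config_at o s) = config_at o.+1 s') ->
  forall Q : rstate -> Prop, Q s' -> reach 1 (code1 i) s Q.
Proof.
move=> Ei Q Qs' pre post; exists 1, s'; split=> //=.
by rewrite step_at Ei addn1.
Qed.

Lemma reach_seq T1 T2 c1 c2 s Q :
  reach T1 c1 s (fun s' => reach T2 c2 s' Q) -> reach (T1 + T2) (c1 ;; c2) s Q.
Proof.
move=> H pre post; rewrite /code_seq -catA.
have [t1 [s1 [le1 run1 H2]]] := H pre (c2 (size pre + size (c1 (size pre))) ++ post).
have [t2 [s2 [le2 run2 Qs2]]] := H2 (pre ++ c1 (size pre)) post.
rewrite size_cat -catA in run2.
exists (t2 + t1), s2; split=> //; first by rewrite addnC leq_add.
by rewrite iterD run1 run2 size_cat addnA.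
Qed.

Lemma reach_ifne T a b c s (Q : rstate -> Prop) :
  (rmem s a = rmem s b -> Q s) ->
  (rmem s a <> rmem s b -> reach T c s Q) ->
  reach T.+1 (code_ifne a b c) s Q.
Proof.
move=> Heq Hne pre post; rewrite /code_ifne /=.
have [Eab|Nab] := eqVneq (rmem s a) (rmem s b).
  exists 1, s; split; [by []| |exact: Heq].
  by rewrite /= step_at /= Eab eqxx addnS.
have [t [s' [le_t run Qs']]] := Hne (elimN eqP Nab)
  (rcons pre (IJeq a b (size pre + size (c (size pre).+1)).+1)) post.
rewrite size_rcons cat_rcons in run.
exists t.+1, s'; split=> //; rewrite iterSr step_at /= (negPf Nab) addnS.
exact: run.
Qed.

(** The number [n] of rounds is known in advance. Each round costs its body and two jumps; the final
    successor pays for the test that leaves the loop. *)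
Lemma reach_while T a b c n (Inv : nat -> rstate -> Prop) s :
  Inv 0 s ->
  (forall i s', i < n -> Inv i s' ->
     rmem s' a <> rmem s' b /\ reach T c s' (Inv i.+1)) ->
  (forall s', Inv n s' -> rmem s' a = rmem s' b) ->
  reach (n * T.+2).+1 (code_while a b c) s (Inv n).
Proof.
move=> I0 Hbody Hend pre post; rewrite /code_while /=.
set o := size pre; set p := c o.+1; set P := _ ++ _ :: _.
have {}Hbody i s' : i < n -> Inv i s' -> exists t s2,
  [/\ t <= T.+2, iter t (step P) (config_at o s') = config_at o s2 & Inv i.+1 s2].
  move=> lt_in Is'; have [/eqP Nab run] := Hbody i s' lt_in Is'.
  have [t [s2 [le_t run2 Is2]]] :=
    run (rcons pre (IJeq a b (o + size p).+2)) (IJeq a a o :: post).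
  rewrite size_rcons cat_rcons -/o -/p in run2.
  have EP : P = pre ++ IJeq a b (o + size p).+2 :: p ++ IJeq a a o :: post.
    by rewrite /P -catA.
  exists t.+2, s2; split=> //.
  rewrite iterS iterSr EP step_at /= (negPf Nab) run2.
  have -> : pre ++ IJeq a b (o + size p).+2 :: p ++ IJeq a a o :: post
    = (pre ++ IJeq a b (o + size p).+2 :: p) ++ IJeq a a o :: post.
    by rewrite -catA.
  have -> : o.+1 + size p = size (pre ++ IJeq a b (o + size p).+2 :: p).
    by rewrite size_cat /= addnS.
  by rewrite step_at /= eqxx.
have Hall i : i <= n -> exists t s', [/\ t <= i * T.+2,
    iter t (step P) (config_at o s) = config_at o s' & Inv i s'].
  elim: i => [_|i IHi lt_in]; first by exists 0, s.
  have [t [s1 [le_t run1 I1]]] := IHi (ltnW lt_in).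
  have [t' [s2 [le_t' run2 I2]]] := Hbody i s1 lt_in I1.
  by exists (t' + t), s2; split=> //; [rewrite mulSn leq_add|rewrite iterD run1].
have [t [s' [le_t run Is']]] := Hall n (leqnn n).
exists t.+1, s'; split=> //.
rewrite iterS run /P step_at /= (Hend _ Is') eqxx /config_at.
by rewrite size_cat /= addn1 !addnS.
Qed.

Lemma reach_halt c T x Q (P := c 0) :
  reach T c (RState (fun=> 0) x [::]) Q ->
  exists t s, [/\ t <= T, computes_within P x t (rout s) & Q s].
Proof.
move=> H; have [t [s [le_t run Qs]]] := H [::] [::].
rewrite /= cats0 in run.
by exists t, s; split=> //; rewrite /computes_within /initial run /halted /=.
Qed.

(** * Expressions *)

(** The base [B + 2] is at least 2 for every [B], so a constant is absorbed by a power, and a sum of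
    two powers by one further factor. *)
Definition poly_bounded (f : nat -> nat) := exists D, forall B, f B <= (B + 2) ^ D.

Lemma leq_exp_base B D E : D <= E -> (B + 2) ^ D <= (B + 2) ^ E.
Proof. by move=> le_DE; rewrite leq_pexp2l ?addn2. Qed.

Lemma poly_cst n : poly_bounded (fun=> n).
Proof.
exists n => B; apply: leq_trans (ltnW (ltn_expl n (ltnSn 1))) _.
by case: n => // n; rewrite leq_exp2r ?leq_addl.
Qed.

Lemma poly_id : poly_bounded id.
Proof. by exists 1 => B; rewrite expn1 leq_addr. Qed.

Lemma poly_mul f g :
  poly_bounded f -> poly_bounded g -> poly_bounded (fun B => f B * g B).
Proof.
by move=> [D HD] [E HE]; exists (D + E) => B; rewrite expnD leq_mul.
Qed.

Lemma poly_add f g :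
  poly_bounded f -> poly_bounded g -> poly_bounded (fun B => f B + g B).
Proof.
move=> [D HD] [E HE]; exists (maxn D E).+1 => B; rewrite expnS.
apply: (@leq_trans (2 * (B + 2) ^ maxn D E)); last first.
  by rewrite leq_mul2r leq_addl orbT.
rewrite mul2n -addnn leq_add //.
- exact: leq_trans (HD B) (leq_exp_base _ (leq_maxl _ _)).
- exact: leq_trans (HE B) (leq_exp_base _ (leq_maxr _ _)).
Qed.

Lemma poly_comp f g :
  poly_bounded f -> poly_bounded g -> poly_bounded (fun B => f (g B)).
Proof.
move=> [D HD] pg; have [E HE] := poly_add pg (poly_cst 2).
exists (E * D) => B; apply: leq_trans (HD _) _; rewrite expnM.
by case: D {HD} => [|D] //; rewrite leq_exp2r.
Qed.

Ltac poly_tac := repeat (first [ eassumption | exact: poly_id | exact: poly_cst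
  | apply: poly_add | apply: poly_mul | match goal with
      H : poly_bounded ?f |- poly_bounded (fun B => ?f (@?g B)) =>
        apply: (@poly_comp f g) end ]).

Definition store := nat -> nat -> nat.

Definition upd (sg : store) a i v : store :=
  fun b j => if (b == a) && (j == i) then v else sg b j.

(** Evaluation has no side effect. [Sum] doubles as a bounded existential quantifier, so that a
    whole entry of the table is given by one expression. *)
Inductive expr :=
  | Cst of nat
  | Get of nat & expr
  | Plus of expr & expr
  | Monus of expr & expr
  | Times of expr & expr
  | Sum of nat & expr & expr.

Fixpoint ev (sg : store) e : nat :=
  match e with
  | Cst n => n
  | Get a e1 => sg a (ev sg e1)
  | Plus e1 e2 => ev sg e1 + ev sg e2
  | Monus e1 e2 => ev sg e1 - ev sg e2
  | Times e1 e2 => ev sg e1 * ev sg e2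
  | Sum x e1 e2 => \sum_(i <- iota 0 (ev sg e1)) ev (upd sg x 0 i) e2
  end.

Definition bounded B (sg : store) := forall a i, sg a i <= B.

Lemma bounded_upd B sg a i v : bounded B sg -> v <= B -> bounded B (upd sg a i v).
Proof. by move=> bd le_v b j; rewrite /upd; case: ifP. Qed.

(** The degree depends on the syntax alone. The index of a sum may exceed [B], so its body is
    estimated with [B + F B], which dominates both the store and the index. *)
Lemma ev_bound e :
  exists2 F, poly_bounded F & forall B sg, bounded B sg -> ev sg e <= F B.
Proof.
elim: e => [n|a e [F pF HF]|e1 [F pF HF] e2 [G pG HG]|e1 [F pF HF] e2 [G pG HG]
           |e1 [F pF HF] e2 [G pG HG]|x e1 [F pF HF] e2 [G pG HG]] /=.
- by exists (fun=> n) => //; apply: poly_cst.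
- by exists id => // ; apply: poly_id.
- exists (fun B => F B + G B) => [|B sg bd]; first by poly_tac.
  by rewrite leq_add ?HF ?HG.
- exists F => // B sg bd; apply: leq_trans (leq_subr _ _) _; exact: HF.
- exists (fun B => F B * G B) => [|B sg bd]; first by poly_tac.
  by rewrite leq_mul ?HF ?HG.
exists (fun B => F B * G (B + F B)) => [|B sg bd]; first by poly_tac.
apply: (@leq_trans (\sum_(i <- iota 0 (ev sg e1)) G (B + F B))).
  rewrite [leqLHS]big_seq [leqRHS]big_seq leq_sum // => i; rewrite mem_iota /= => lt_i.
  apply: HG; apply: bounded_upd => [b j|].
    by apply: leq_trans (bd b j) _; rewrite leq_addr.
  by apply: leq_trans (ltnW lt_i) _; apply: leq_trans (HF _ _ bd) _; rewrite leq_addl.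
by rewrite big_const_seq iter_addn_0 count_predT size_iota mulnC leq_mul2r HF ?orbT.
Qed.

Definition setm s x v := RState [eta rmem s with x |-> v] (rin s) (rout s).

Lemma reach_set x c s (Q : rstate -> Prop) :
  Q (setm s x c) -> reach 1 (code1 (ISet x c)) s Q.
Proof. by apply: reach_instr. Qed.
Lemma reach_copy x y s (Q : rstate -> Prop) :
  Q (setm s x (rmem s y)) -> reach 1 (code1 (ICopy x y)) s Q.
Proof. by apply: reach_instr. Qed.
Lemma reach_succ x s (Q : rstate -> Prop) :
  Q (setm s x (rmem s x).+1) -> reach 1 (code1 (ISucc x)) s Q.
Proof. by apply: reach_instr. Qed.
Lemma reach_pred x s (Q : rstate -> Prop) :
  Q (setm s x (rmem s x).-1) -> reach 1 (code1 (IPred x)) s Q.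
Proof. by apply: reach_instr. Qed.
Lemma reach_load x y s (Q : rstate -> Prop) :
  Q (setm s x (rmem s (rmem s y))) -> reach 1 (code1 (ILoad x y)) s Q.
Proof. by apply: reach_instr. Qed.
Lemma reach_store x y s (Q : rstate -> Prop) :
  Q (setm s (rmem s x) (rmem s y)) -> reach 1 (code1 (IStore x y)) s Q.
Proof. by apply: reach_instr. Qed.
Lemma reach_read x s (Q : rstate -> Prop) :
  Q (RState [eta rmem s with x |-> head 0 (rin s)] (behead (rin s)) (rout s)) ->
  reach 1 (code1 (IRead x)) s Q.
Proof. by apply: reach_instr. Qed.
Lemma reach_write x s (Q : rstate -> Prop) :
  Q (RState (rmem s) (rin s) (rcons (rout s) (rmem s x))) ->
  reach 1 (code1 (IWrite x)) s Q.
Proof. by apply: reach_instr. Qed.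

(* Code for [m[x] := iter m[y] f m[x]; m[y] := 0], where [c] does
   [m[x] := f m[x]] and [m[z] = 0]. *)
Definition code_drain y z (c : code) : code :=
  code_while y z (c ;; code1 (IPred y)).

Definition drained x y v s s' :=
  [/\ rin s' = rin s, rout s' = rout s
    & forall p, rmem s' p = if p == y then 0 else if p == x then v else rmem s p].

Definition assigned x v s s' :=
  [/\ rin s' = rin s, rout s' = rout s
    & forall p, rmem s' p = if p == x then v else rmem s p].

(** Only equality can be tested, so [y] is counted down until it agrees with the zero cell [z].
    Sums, differences, products and addresses are all obtained from this loop. *)
Lemma reach_drain T x y z c f s :
  (forall s, reach T c s (assigned x (f (rmem s x)) s)) ->
  y != x -> z != x -> z != y -> rmem s z = 0 ->
  reach (rmem s y * (T + 3)).+1 (code_drain y z c) s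
    (drained x y (iter (rmem s y) f (rmem s x)) s).
Proof.
move=> Hc Nyx Nzx Nzy Ez.
pose Inv i s' := [/\ rin s' = rin s, rout s' = rout s
  & forall p, rmem s' p = if p == y then rmem s y - i
              else if p == x then iter i f (rmem s x) else rmem s p].
have Exy : (x == y) = false by rewrite eq_sym (negPf Nyx).
apply: (@reach_weaken (rmem s y * (T + 1).+2).+1 _ _ _ (Inv (rmem s y))).
- apply: reach_while.
  + by split=> // p; rewrite subn0; case: eqP => [->|_] //; case: eqP => [->|].
  + move=> i s' lt_i [Ein Eout Em]; split.
      by rewrite !Em eqxx (negPf Nzx) (negPf Nzy) Ez; lia.
    apply: reach_seq; apply: reach_weaken (Hc s') (leqnn _) _.
    move=> s2 [Ein2 Eout2 Em2]; apply: reach_pred; split=> /= [||p].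
    * by rewrite Ein2.
    * by rewrite Eout2.
    rewrite !Em2 (negPf Nyx) !Em eqxx.
    case: (p =P y) => [_|_] /=; first by rewrite subnS.
    by case: (p =P x) => // _; rewrite Exy eqxx.
  + by move=> s' [_ _ Em]; rewrite !Em eqxx (negPf Nzx) (negPf Nzy) Ez subnn.
- by rewrite addn1 addnC.
- by move=> s' [Ein Eout Em]; split=> // p; rewrite Em subnn.
Qed.

Lemma reach_assign_instr i x f s :
  (forall s o, exec i (config_at o s) = config_at o.+1 (setm s x (f (rmem s x)))) ->
  reach 1 (code1 i) s (assigned x (f (rmem s x)) s).
Proof. by move=> Ei; apply: reach_instr (Ei s) _ _. Qed.

Lemma iter_succn n m : iter n succn m = m + n.
Proof. by elim: n => [|n /= ->]; rewrite ?addn0 ?addnS. Qed.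

Lemma iter_predn n m : iter n predn m = m - n.
Proof. by elim: n => [|n /= ->]; rewrite ?subn0 ?subnS. Qed.

Fixpoint code_succs n x : code :=
  if n is n'.+1 then code1 (ISucc x) ;; code_succs n' x
  else code1 (ICopy x x).

Lemma reach_succs n x s :
  reach n.+1 (code_succs n x) s (assigned x (rmem s x + n) s).
Proof.
elim: n s => [|n IHn] s /=.
  by apply: reach_copy; split=> //= p; rewrite addn0.
apply: (@reach_seq 1); apply: reach_succ; apply: reach_weaken (IHn _) (leqnn _) _.
move=> s' [Ein Eout Em]; split=> //= p; rewrite Em /= eqxx addSnnS.
by case: eqP.
Qed.

Section Layout.

Variable V : nat.

(* The unbounded arrays [a < V] are interleaved in memory, together with an
   array [V] of temporaries; a variable is the cell [0] of an array. *)
Definition adr a i := i * V.+1 + a.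
Definition tmp t := adr V t.

Lemma adr_eq a b i j : a <= V -> b <= V ->
  (adr a i == adr b j) = (a == b) && (i == j).
Proof.
move=> le_a le_b; apply/eqP/andP => [E|[/eqP-> /eqP->]] //.
have := congr1 (modn^~ V.+1) E; rewrite /= !modnMDl !modn_small // => ->.
have := congr1 (divn^~ V.+1) E; rewrite /= !divnMDl // !divn_small // !addn0.
by move=> ->; rewrite !eqxx.
Qed.

Lemma tmp_eq i j : (tmp i == tmp j) = (i == j).
Proof. by rewrite adr_eq ?eqxx. Qed.

Lemma adr_tmp a i j : a < V -> (adr a i == tmp j) = false.
Proof. by move=> lt_a; rewrite adr_eq ?(ltnW lt_a) // ltn_eqF. Qed.

Lemma tmp_adr a i j : a < V -> (tmp j == adr a i) = false.
Proof. by move=> lt_a; rewrite eq_sym adr_tmp. Qed.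

End Layout.

Ltac tmpE := rewrite /= ?tmp_eq;
  repeat match goal with |- context [@eq_op _ ?a ?b] =>
    first [ rewrite (_ : (a == b) = false); [|by lia]
          | rewrite (_ : (a == b) = true); [|by lia] ] end; rewrite //=.

(** * Compilation of expressions *)

Section Compile.

Variable V : nat.
Notation adr := (adr V).
Notation tmp := (tmp V).

(** Builds the address [i * V.+1 + a] without a multiplication: [tmp d.+1] starts at [a] and gains
    [V.+1] for each unit of the index in [tmp d], which is consumed. *)
Definition code_addr a d : code :=
  (code1 (ISet (tmp d.+1) a) ;; code1 (ISet (tmp d.+2) 0) ;;
   code_drain (tmp d) (tmp d.+2) (code_succs V.+1 (tmp d.+1)))%code.

Definition code_into d c : code :=
  (code1 (ISet (tmp d.+2) 0) ;; code_drain (tmp d.+1) (tmp d.+2) c)%code.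

(** The temporaries form a stack: the value goes to [tmp d], and only temporaries from [d] on serve
    as scratch space. Draining destroys an operand, hence the fresh copy of the second factor in
    each round of [Times]. [Sum] saves the cell of its index and restores it at the end, so the
    arrays are left unchanged. *)
Fixpoint cexpr e d : code :=
  match e with
  | Cst n => code1 (ISet (tmp d) n)
  | Get a e1 => cexpr e1 d ;; code_addr a d ;; code1 (ILoad (tmp d) (tmp d.+1))
  | Plus e1 e2 => cexpr e1 d ;; cexpr e2 d.+1 ;; code_into d (code1 (ISucc (tmp d)))
  | Monus e1 e2 => cexpr e1 d ;; cexpr e2 d.+1 ;; code_into d (code1 (IPred (tmp d)))
  | Times e1 e2 =>
      code1 (ISet (tmp d) 0) ;; cexpr e1 d.+1 ;; cexpr e2 d.+2 ;;
      code1 (ISet (tmp d.+4) 0) ;;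
      code_while (tmp d.+1) (tmp d.+4)
        (code1 (ICopy (tmp d.+3) (tmp d.+2)) ;;
         code_drain (tmp d.+3) (tmp d.+4) (code1 (ISucc (tmp d))) ;;
         code1 (IPred (tmp d.+1)))
  | Sum x e1 e2 =>
      code1 (ISet (tmp d) 0) ;; cexpr e1 d.+1 ;;
      code1 (ISet (tmp d.+2) 0) ;; code1 (ICopy (tmp d.+3) (adr x 0)) ;;
      code_while (tmp d.+2) (tmp d.+1)
        (code1 (ICopy (adr x 0) (tmp d.+2)) ;; cexpr e2 d.+4 ;;
         code1 (ISet (tmp d.+4.+1) 0) ;;
         code_drain (tmp d.+4) (tmp d.+4.+1) (code1 (ISucc (tmp d))) ;;
         code1 (ISucc (tmp d.+2))) ;;
      code1 (ICopy (adr x 0) (tmp d.+3))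
  end%code.

Fixpoint wf_expr e :=
  match e with
  | Cst _ => true
  | Get a e1 => (a < V) && wf_expr e1
  | Plus e1 e2 | Monus e1 e2 | Times e1 e2 => wf_expr e1 && wf_expr e2
  | Sum x e1 e2 => [&& x < V, wf_expr e1 & wf_expr e2]
  end.

Definition represents (sg : store) s := forall a i, a < V -> rmem s (adr a i) = sg a i.

(** Everything but the temporaries from [d] on is preserved: the arrays, and the lower temporaries
    with the pending values of enclosing expressions. *)
Definition same_below d s s' :=
  forall p, (forall j, d <= j -> p != tmp j) -> rmem s' p = rmem s p.

Definition evaluated d v s s' :=
  [/\ rin s' = rin s, rout s' = rout s, same_below d s s' & rmem s' (tmp d) = v].

Lemma reach_addr a d s (Q : rstate -> Prop) :
  (forall s', rin s' = rin s -> rout s' = rout s ->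
    rmem s' (tmp d.+1) = adr a (rmem s (tmp d)) ->
    (forall p, p != tmp d -> p != tmp d.+1 -> p != tmp d.+2 ->
       rmem s' p = rmem s p) -> Q s') ->
  reach (rmem s (tmp d) * (V + 5) + 3) (code_addr a d) s Q.
Proof.
move=> HQ; apply: (@reach_weaken (1 + (1 + (rmem s (tmp d) * (V.+2 + 3)).+1)) _ _ _ Q);
  [|lia|by []].
apply: reach_seq; apply: reach_set; apply: reach_seq; apply: reach_set.
set s1 := setm _ _ _.
have E0 : rmem s1 (tmp d) = rmem s (tmp d) by tmpE.
have E1 : rmem s1 (tmp d.+1) = a by tmpE.
have E2 : rmem s1 (tmp d.+2) = 0 by rewrite /= eqxx.
rewrite -E0; apply: reach_weaken (leqnn _) _.
  apply: (@reach_drain _ (tmp d.+1) (tmp d) (tmp d.+2) _ (addn^~ V.+1)) => //.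
  - by move=> s2; apply: reach_succs.
  - by tmpE.
  - by tmpE.
  - by tmpE.
move=> s' [Ein Eout Em]; apply: HQ => //.
  rewrite Em E1 E0 /adr; tmpE.
  by elim: (rmem s _) => //= n ->; rewrite mulSn; lia.
move=> p N0 N1 N2; rewrite Em (negPf N0) (negPf N1) /=.
by rewrite (negPf N1) (negPf N2).
Qed.

Lemma reach_into d T c f s (Q : rstate -> Prop) :
  (forall s, reach T c s (assigned (tmp d) (f (rmem s (tmp d))) s)) ->
  (forall s', rin s' = rin s -> rout s' = rout s ->
    rmem s' (tmp d) = iter (rmem s (tmp d.+1)) f (rmem s (tmp d)) ->
    (forall p, p != tmp d -> p != tmp d.+1 -> p != tmp d.+2 ->
       rmem s' p = rmem s p) -> Q s') ->
  reach (rmem s (tmp d.+1) * (T + 3) + 2) (code_into d c) s Q.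
Proof.
move=> Hc HQ; apply: (@reach_weaken (1 + (rmem s (tmp d.+1) * (T + 3)).+1) _ _ _ Q);
  [|lia|by []].
apply: reach_seq; apply: reach_set.
set s1 := setm _ _ _.
have E0 : rmem s1 (tmp d) = rmem s (tmp d) by tmpE.
have E1 : rmem s1 (tmp d.+1) = rmem s (tmp d.+1)
  by tmpE.
have E2 : rmem s1 (tmp d.+2) = 0 by rewrite /= eqxx.
rewrite -E1; apply: reach_weaken (leqnn _) _.
  apply: (@reach_drain _ (tmp d) (tmp d.+1) (tmp d.+2) _ f) => //.
  - by tmpE.
  - by tmpE.
  - by tmpE.
move=> s' [Ein Eout Em]; apply: HQ => //.
  by rewrite Em E1 E0; tmpE.
by move=> p N0 N1 N2; rewrite Em (negPf N0) (negPf N1) /= (negPf N2).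
Qed.

Lemma same_below_tmp d s s' t : same_below d s s' -> t < d ->
  rmem s' (tmp t) = rmem s (tmp t).
Proof. by move=> H lt_t; apply: H => j le_j; tmpE. Qed.

Lemma same_below_adr d s s' a i : same_below d s s' -> a < V ->
  rmem s' (adr a i) = rmem s (adr a i).
Proof. by move=> H lt_a; apply: H => j _; rewrite adr_tmp. Qed.

Lemma represents_same d sg s s' :
  represents sg s -> same_below d s s' -> represents sg s'.
Proof. by move=> rep H a i lt_a; rewrite (same_below_adr _ H) // rep. Qed.

Lemma same_below_refl d s : same_below d s s.
Proof. by []. Qed.

Lemma same_below_trans d d' s1 s2 s3 : d <= d' ->
  same_below d s1 s2 -> same_below d' s2 s3 -> same_below d s1 s3.
Proof.
move=> le_d H1 H2 p Hp; rewrite H2 ?H1 // => j le_j.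
exact/Hp/(leq_trans le_d).
Qed.

Lemma same_below_setm d t v s : d <= t -> same_below d s (setm s (tmp t) v).
Proof. by move=> le_d p Hp /=; rewrite (negPf (Hp _ le_d)). Qed.

Lemma same_below_three d e s s' :
  (forall p, p != tmp d -> p != tmp d.+1 -> p != tmp d.+2 ->
     rmem s' p = rmem s p) -> e <= d -> same_below e s s'.
Proof. by move=> H le_e p Hp; apply: H; apply: Hp; lia. Qed.

(** Serves addition and truncated subtraction alike, as iterated successor and iterated
    predecessor. *)
Lemma cexpr_op e1 e2 c f T1 T2 F2 B sg d s : bounded B sg -> represents sg s ->
  (forall d s, represents sg s -> reach (T1 B) (cexpr e1 d) s (evaluated d (ev sg e1) s)) ->
  (forall d s, represents sg s -> reach (T2 B) (cexpr e2 d) s (evaluated d (ev sg e2) s)) ->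
  ev sg e2 <= F2 B ->
  (forall s, reach 1 c s (assigned (tmp d) (f (rmem s (tmp d))) s)) ->
  reach (T1 B + (T2 B + (F2 B * 4 + 2)))
    (cexpr e1 d ;; cexpr e2 d.+1 ;; code_into d c)%code s
    (evaluated d (iter (ev sg e2) f (ev sg e1)) s).
Proof.
move=> bd rep H1 H2 HF Hc.
apply: reach_seq; apply: reach_weaken (H1 d s rep) (leqnn _) _.
move=> s1 [in1 out1 same1 v1].
have rep1 := represents_same rep same1.
apply: reach_seq; apply: reach_weaken (H2 d.+1 s1 rep1) (leqnn _) _.
move=> s2 [in2 out2 same2 v2].
apply: (@reach_weaken (rmem s2 (tmp d.+1) * (1 + 3) + 2) _ _ _
  (evaluated d (iter (ev sg e2) f (ev sg e1)) s)) => //; last first.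
  by rewrite v2 leq_add2r leq_mul2r HF orbT.
apply: reach_into Hc _ => s3 in3 out3 v3 same3; split.
- by rewrite in3 in2.
- by rewrite out3 out2.
- have same23 := same_below_three same3 (leqnn d).
  apply: same_below_trans (leqnn d) same1 (same_below_trans (leqnn d) _ same23).
  exact: same_below_trans (leqnSn d) (@same_below_refl _ _) same2.
- by rewrite v3 v2 (same_below_tmp same2) ?v1.
Qed.

Lemma reach_mul d s n1 n2 : rmem s (tmp d) = 0 ->
  rmem s (tmp d.+1) = n1 -> rmem s (tmp d.+2) = n2 ->
  reach (n1 * (n2 * 4 + 5) + 2)
    (code1 (ISet (tmp d.+4) 0) ;;
      code_while (tmp d.+1) (tmp d.+4)
        (code1 (ICopy (tmp d.+3) (tmp d.+2)) ;;
         code_drain (tmp d.+3) (tmp d.+4) (code1 (ISucc (tmp d))) ;;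
         code1 (IPred (tmp d.+1))))%code s (evaluated d (n1 * n2) s).
Proof.
move=> v0 v1 v2.
pose Inv i s' := [/\ evaluated d (i * n2) s s', rmem s' (tmp d.+1) = n1 - i,
  rmem s' (tmp d.+2) = n2 & rmem s' (tmp d.+4) = 0].
apply: (@reach_weaken (1 + (n1 * (1 + ((n2 * 4).+1 + 1)).+2).+1) _ _ _
  (evaluated d (n1 * n2) s)); [|lia|by []].
apply: reach_seq; apply: reach_set.
apply: (reach_weaken (reach_while (Inv := Inv) (n := n1) _ _ _) (leqnn _)).
- split; last by tmpE.
  + by split=> //; [apply: same_below_setm; lia | rewrite mul0n; tmpE].
  + by rewrite subn0; tmpE.
  + by tmpE.
- move=> i s1 lt_i [[in1 out1 same1 a1] b1 c1 z1]; split.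
    by rewrite b1 z1; lia.
  apply: reach_seq; apply: reach_copy; apply: reach_seq.
  set s2 := setm _ _ _.
  have E3 : rmem s2 (tmp d.+3) = n2 by rewrite -c1; tmpE.
  rewrite -{1}E3; apply: reach_weaken (leqnn _) _.
    apply: (@reach_drain 1 (tmp d) (tmp d.+3) (tmp d.+4) _ succn); try by tmpE.
    by move=> s3; apply: (@reach_assign_instr _ _ succn).
  move=> s3 [in3 out3 m3]; apply: reach_pred.
  split; last by rewrite /= !m3 /s2; tmpE.
  + split=> /=; [by rewrite in3|by rewrite out3| |].
      move=> p Hp; rewrite /= !m3 /s2 /= !(negPf (Hp _ _)) ?same1 //; lia.
    by rewrite !m3 E3 iter_succn /s2; tmpE; rewrite a1 mulSn addnC.
  + by rewrite /= !m3 /s2; tmpE; rewrite b1 subnS.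
  + by rewrite /= !m3 /s2; tmpE.
- by move=> s1 [_ b1 _ z1]; rewrite b1 z1 subnn.
- by move=> s1 [].
Qed.

Lemma cexpr_sum x e1 e2 T1 T2 n F B sg d s : bounded B sg -> represents sg s ->
  x < V -> ev sg e1 = n -> n <= B ->
  (forall d s, represents sg s -> reach T1 (cexpr e1 d) s (evaluated d n s)) ->
  (forall i d s, i < n -> represents (upd sg x 0 i) s ->
     reach T2 (cexpr e2 d) s (evaluated d (ev (upd sg x 0 i) e2) s)) ->
  (forall i, i < n -> ev (upd sg x 0 i) e2 <= F) ->
  reach (T1 + (n * (T2 + F * 4 + 6) + 5)) (cexpr (Sum x e1 e2) d) s
    (evaluated d (ev sg (Sum x e1 e2)) s).
Proof.
move=> bd rep lt_x En le_n H1 H2 HF.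
apply: (@reach_weaken (1 + (T1 + (1 + (1 + ((n * (1 + (T2 + (1 + ((F * 4).+1 + 1)))).+2).+1
  + 1)))))
  _ _ _ (evaluated d (ev sg (Sum x e1 e2)) s)); [|lia|by []].
apply: reach_seq; apply: reach_set; apply: reach_seq.
apply: reach_weaken (H1 d.+1 _ _) (leqnn _) _.
  by apply: represents_same rep _; apply: (@same_below_setm d d 0).
move=> s1 [in1 out1 same1 v1].
apply: reach_seq; apply: reach_set; apply: reach_seq; apply: reach_copy.
rewrite /= adr_tmp //.
pose f i := ev (upd sg x 0 i) e2.
pose tsum i := \sum_(j <- iota 0 i) f j.
have tsumS i : tsum i.+1 = tsum i + f i.
  by rewrite /tsum -addn1 iotaD big_cat big_seq1.
(* The body overwrites the cell of [x], so [same_below] fails during the loop. The invariant exempts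
   this cell and records its old value in [tmp d.+3], from which the last instruction restores
   it. *)
pose Inv i s' := [/\ [/\ rin s' = rin s, rout s' = rout s &
    forall p, p != adr x 0 -> (forall j, d <= j -> p != tmp j) -> rmem s' p = rmem s p],
  rmem s' (tmp d) = tsum i, rmem s' (tmp d.+1) = n,
  rmem s' (tmp d.+2) = i & rmem s' (tmp d.+3) = rmem s (adr x 0)].
apply: reach_seq.
apply: (reach_weaken (reach_while (Inv := Inv) (n := n) _ _ _) (leqnn _)).
- split.
  + split=> // p _ Hp /=; rewrite !(negPf (Hp _ _)); try lia.
    by rewrite same1 /= ?(negPf (Hp _ _)) // => j le_j; apply: Hp; lia.
  + by tmpE; rewrite (same_below_tmp same1) /= ?eqxx /tsum ?big_nil.
  + by tmpE; rewrite v1.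
  + by tmpE.
  + by tmpE; rewrite (same_below_adr _ same1) //= adr_tmp.
- move=> i s2 lt_i [[in2 out2 m2] a2 b2 c2 d2]; split; first by rewrite b2 c2; lia.
  apply: reach_seq; apply: reach_copy; apply: reach_seq.
  apply: reach_weaken (H2 i d.+4 _ lt_i _) (leqnn _) _.
    move=> a j lt_a; rewrite /= adr_eq ?(ltnW lt_a) ?(ltnW lt_x) // /upd c2.
    case: ifP => // Nx; rewrite m2 ?rep //.
      by rewrite adr_eq ?(ltnW lt_a) ?(ltnW lt_x) // Nx.
    by move=> t _; rewrite adr_tmp.
  move=> s3 [in3 out3 same3 v3]; apply: reach_seq; apply: reach_set; apply: reach_seq.
  set s4 := setm _ _ _.
  have E4 : rmem s4 (tmp d.+4) = f i by rewrite /f -v3; tmpE.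
  apply: (reach_weaken (T := (f i * 4).+1)); last by move=> s5; exact.
    rewrite -E4; apply: reach_weaken (leqnn _) _.
      apply: (@reach_drain 1 (tmp d) (tmp d.+4) (tmp d.+4.+1) _ succn); try by tmpE.
      by move=> s5; apply: (@reach_assign_instr _ _ succn).
    rewrite E4 => s5 [in5 out5 m5]; apply: reach_succ; split.
    + split=> /=; [by rewrite in5 in3|by rewrite out5 out3|].
      move=> p Nx Hp; rewrite /= !m5 /s4 /= !(negPf (Hp _ _)) ?(negPf (Hp _ _)); try lia.
      rewrite same3 /= ?(negPf Nx) ?m2 // => j le_j; apply: Hp; lia.
    + rewrite /= !m5 /s4; tmpE; rewrite iter_succn !(same_below_tmp same3) /= ?tmp_adr //; try lia.
      by rewrite a2 tsumS.
    + by rewrite /= !m5 /s4; tmpE; rewrite !(same_below_tmp same3) /= ?tmp_adr //; lia.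
    + by rewrite /= !m5 /s4; tmpE; rewrite !(same_below_tmp same3) /= ?tmp_adr ?c2 //; lia.
    + by rewrite /= !m5 /s4; tmpE; rewrite !(same_below_tmp same3) /= ?tmp_adr ?c2 //; lia.
  by rewrite ltnS leq_mul2r HF // orbT.
- by move=> s2 [_ _ b2 c2 _]; rewrite b2 c2.
move=> s2 [[in2 out2 m2] a2 b2 c2 d2]; apply: reach_copy; split=> //=.
- move=> p Hp /=; case: eqP => [->|/eqP Nx]; first by rewrite d2.
  exact: m2.
- by rewrite tmp_adr // a2 /= En.
Qed.

Lemma cexpr_sound e : wf_expr e -> exists2 T, poly_bounded T &
  forall B sg d s, bounded B sg -> represents sg s ->
  reach (T B) (cexpr e d) s (evaluated d (ev sg e) s).
Proof.
elim: e => [n|a e IH|e1 IH1 e2 IH2|e1 IH1 e2 IH2|e1 IH1 e2 IH2|x e1 IH1 e2 IH2] /=.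
- exists (fun=> 1) => [|B sg d s bd rep]; first exact: poly_cst.
  by apply: reach_set; split=> //=; [apply: same_below_setm|rewrite eqxx].
- move=> /andP[lt_a /IH[T pT HT]]; have [F pF HF] := ev_bound e.
  exists (fun B => T B + ((F B * (V + 5) + 3) + 1)) => [|B sg d s bd rep].
    by poly_tac.
  apply: reach_seq; apply: reach_weaken (HT B sg d s bd rep) (leqnn _) _.
  move=> s1 [in1 out1 same1 v1]; apply: reach_seq.
  apply: (reach_weaken (T := rmem s1 (tmp d) * (V + 5) + 3)); last by move=> s2; exact.
    apply: reach_addr => s2 in2 out2 v2 m2; apply: reach_load; split=> /=.
    + by rewrite in2.
    + by rewrite out2.
    + move=> p Hp; rewrite /= (negPf (Hp _ _)) // m2 ?same1 //; apply: Hp; lia.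
    rewrite eqxx v2 m2 ?adr_tmp // v1 (same_below_adr _ same1) // rep //.
  by rewrite v1 leq_add2r leq_mul2r HF ?orbT.
- move=> /andP[/IH1[T1 pT1 H1] /IH2[T2 pT2 H2]]; have [F pF HF] := ev_bound e2.
  exists (fun B => T1 B + (T2 B + (F B * 4 + 2))) => [|B sg d s bd rep].
    by poly_tac.
  rewrite -[ev sg e1 + _]iter_succn; apply: cexpr_op (bd) rep _ _ (HF _ _ bd) _.
  + by move=> d' s' rep'; apply: H1.
  + by move=> d' s' rep'; apply: H2.
  + by move=> s'; apply: (@reach_assign_instr _ _ succn).
- move=> /andP[/IH1[T1 pT1 H1] /IH2[T2 pT2 H2]]; have [F pF HF] := ev_bound e2.
  exists (fun B => T1 B + (T2 B + (F B * 4 + 2))) => [|B sg d s bd rep].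
    by poly_tac.
  rewrite -[ev sg e1 - _]iter_predn; apply: cexpr_op (bd) rep _ _ (HF _ _ bd) _.
  + by move=> d' s' rep'; apply: H1.
  + by move=> d' s' rep'; apply: H2.
  + by move=> s'; apply: (@reach_assign_instr _ _ predn).
- move=> /andP[/IH1[T1 pT1 H1] /IH2[T2 pT2 H2]].
  have [F1 pF1 HF1] := ev_bound e1; have [F2 pF2 HF2] := ev_bound e2.
  exists (fun B => 1 + (T1 B + (T2 B + (F1 B * (F2 B * 4 + 5) + 2)))) => [|B sg d s bd rep].
    by poly_tac.
  apply: reach_seq; apply: reach_set; apply: reach_seq.
  have same0 : same_below d s (setm s (tmp d) 0) by apply: same_below_setm.
  have rep0 := represents_same rep same0.
  apply: reach_weaken (H1 B sg d.+1 _ bd rep0) (leqnn _) _.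
  move=> s1 [in1 out1 same1 v1]; have rep1 := represents_same rep0 same1.
  apply: reach_seq; apply: reach_weaken (H2 B sg d.+2 _ bd rep1) (leqnn _) _.
  move=> s2 [in2 out2 same2 v2].
  have v1' : rmem s2 (tmp d.+1) = ev sg e1 by rewrite (same_below_tmp same2) // v1.
  apply: reach_weaken (reach_mul _ v1' v2) _ _.
  + by rewrite (same_below_tmp same2) // (same_below_tmp same1) //; tmpE.
  + rewrite leq_add2r; apply: leq_mul; first exact: HF1 bd.
    by rewrite leq_add2r leq_mul2r HF2 // orbT.
  move=> s3 [in3 out3 same3 v3]; split=> //.
  + by rewrite in3 in2 in1.
  + by rewrite out3 out2 out1.
  apply: same_below_trans same3 => //.
  apply: (@same_below_trans d d.+2 _ s1) => //; first by lia.
  exact: same_below_trans same0 same1.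
- move=> /and3P[lt_x /IH1[T1 pT1 H1] /IH2[T2 pT2 H2]].
  have [F1 pF1 HF1] := ev_bound e1; have [F2 pF2 HF2] := ev_bound e2.
  exists (fun B => T1 B + (F1 B * (T2 (B + F1 B) + F2 (B + F1 B) * 4 + 6) + 5))
    => [|B sg d s bd rep]; first by poly_tac.
  have le_n := HF1 _ _ bd.
  have bd' i : i < ev sg e1 -> bounded (B + F1 B) (upd sg x 0 i).
    move=> lt_i; apply: bounded_upd => [b j|]; last by lia.
    by apply: leq_trans (bd b j) _; rewrite leq_addr.
  apply: reach_weaken; first apply: (@cexpr_sum x e1 e2 (T1 B) (T2 (B + F1 B))
    _ (F2 (B + F1 B)) (B + F1 B) sg d s _ rep lt_x erefl).
  + by move=> b j; apply: leq_trans (bd b j) _; rewrite leq_addr.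
  + by apply: leq_trans le_n _; rewrite leq_addl.
  + by move=> d' s' rep'; apply: H1.
  + by move=> i d' s' lt_i rep'; apply: H2 => //; apply: bd'.
  + by move=> i lt_i; apply: HF2; apply: bd'.
  + by rewrite leq_add2l leq_add2r leq_mul2r le_n orbT.
  by [].
Qed.
End Compile.

(** * Commands and their weakest preconditions *)

(* In [For x e c] the bound [e] is evaluated once and [x] runs from [0] to
   [e - 1]; [c] may overwrite [x] without affecting the number of rounds. *)
Inductive cmd :=
  | Store of nat & expr & expr
  | Read of nat
  | Write of expr
  | Seq of cmd & cmd
  | If of expr & cmd
  | For of nat & expr & cmd.

Definition post := store -> seq nat -> seq nat -> Prop.

Fixpoint wp_loop (w : post -> post) x i n (Q : post) : post :=
  match n with
  | 0 => Q
  | n.+1 => fun sg inp out => w (wp_loop w x i.+1 n Q) (upd sg x 0 i) inp out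
  end.

(* Weakest precondition for [Q] when no stored value may exceed [B]: the
   running time is then polynomial in [B], see [ccmd_sound]. *)
Fixpoint wp B c (Q : post) : post := fun sg inp out =>
  match c with
  | Store a e1 e2 => ev sg e2 <= B /\ Q (upd sg a (ev sg e1) (ev sg e2)) inp out
  | Read a => head 0 inp <= B /\ Q (upd sg a 0 (head 0 inp)) (behead inp) out
  | Write e => Q sg inp (rcons out (ev sg e))
  | Seq c1 c2 => wp B c1 (wp B c2 Q) sg inp out
  | If e c => if ev sg e == 0 then Q sg inp out else wp B c Q sg inp out
  | For x e c => ev sg e <= B /\ wp_loop (wp B c) x 0 (ev sg e) Q sg inp out
  end.

(** * Compilation of commands *)

Section CompileCmd.

Variable V : nat.
Notation adr := (adr V).
Notation tmp := (tmp V).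

(** A [For] keeps its bound in [tmp d] and its counter in [tmp d.+1], and copies the counter to the
    cell of [x] at the start of each round. The body works from [d.+2] on and cannot disturb
    either. *)
Fixpoint ccmd c d : code :=
  match c with
  | Store a e1 e2 =>
      cexpr V e2 d ;; cexpr V e1 d.+1 ;; code_addr V a d.+1 ;;
      code1 (IStore (tmp d.+2) (tmp d))
  | Read a => code1 (IRead (adr a 0))
  | Write e => cexpr V e d ;; code1 (IWrite (tmp d))
  | Seq c1 c2 => ccmd c1 d ;; ccmd c2 d
  | If e c => cexpr V e d ;; code1 (ISet (tmp d.+1) 0) ;;
      code_ifne (tmp d) (tmp d.+1) (ccmd c d)
  | For x e c => cexpr V e d ;; code1 (ISet (tmp d.+1) 0) ;;
      code_while (tmp d) (tmp d.+1)
        (code1 (ICopy (adr x 0) (tmp d.+1)) ;; ccmd c d.+2 ;;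
         code1 (ISucc (tmp d.+1)))
  end%code.

Fixpoint wf_cmd c :=
  match c with
  | Store a e1 e2 => [&& a < V, wf_expr V e1 & wf_expr V e2]
  | Read a => a < V
  | Write e => wf_expr V e
  | Seq c1 c2 => wf_cmd c1 && wf_cmd c2
  | If e c => wf_expr V e && wf_cmd c
  | For x e c => [&& x < V, wf_expr V e & wf_cmd c]
  end.

(** Unlike expressions, commands change the arrays, so only the lower temporaries, where enclosing
    loops keep bound and counter, have to survive. *)
Definition kept d s s' := forall t, t < d -> rmem s' (tmp t) = rmem s (tmp t).

Definition simulates B d (Q : post) s s' := exists sg',
  [/\ Q sg' (rin s') (rout s'), represents V sg' s', bounded B sg' & kept d s s'].

Lemma kept_trans d s1 s2 s3 : kept d s1 s2 -> kept d s2 s3 -> kept d s1 s3.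
Proof. by move=> H1 H2 t lt_t; rewrite H2 ?H1. Qed.

Lemma kept_same d s s' : same_below V d s s' -> kept d s s'.
Proof. by move=> H t lt_t; apply: (same_below_tmp H). Qed.

Lemma simulates_trans B d Q s1 s2 s3 :
  kept d s1 s2 -> simulates B d Q s2 s3 -> simulates B d Q s1 s3.
Proof.
by move=> H [sg' [q r b k]]; exists sg'; split=> //; apply: kept_trans k.
Qed.

Lemma ccmd_for x T n Q B sg d s w c : bounded B sg -> represents V sg s ->
  x < V -> rmem s (tmp d) = n -> n <= B ->
  (forall d s (Q : post) sg, bounded B sg -> represents V sg s ->
    w Q sg (rin s) (rout s) -> reach T (ccmd c d) s (simulates B d Q s)) ->
  wp_loop w x 0 n Q sg (rin s) (rout s) ->
  reach (n * (T + 4) + 2)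
    (code1 (ISet (tmp d.+1) 0) ;;
      code_while (tmp d) (tmp d.+1)
        (code1 (ICopy (adr x 0) (tmp d.+1)) ;; ccmd c d.+2 ;;
         code1 (ISucc (tmp d.+1))))%code s (simulates B d Q s).
Proof.
move=> bd rep lt_x En le_n Hc Hwp.
(* The invariant is the weakest precondition of the [n - i] rounds still to come, so the source loop
   needs no annotation. *)
pose Inv i s' := exists sg',
  [/\ wp_loop w x i (n - i) Q sg' (rin s') (rout s'), represents V sg' s',
    bounded B sg', kept d s s'
    & rmem s' (tmp d) = n /\ rmem s' (tmp d.+1) = i].
apply: (@reach_weaken (1 + (n * (1 + (T + 1)).+2).+1) _ _ _ (simulates B d Q s));
  [|lia|by []].
apply: reach_seq; apply: reach_set.
have same0 : same_below V d s (setm s (tmp d.+1) 0) by apply: same_below_setm.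
apply: (reach_weaken (reach_while (Inv := Inv) (n := n) _ _ _) (leqnn _)).
- exists sg; split=> //; first by rewrite subn0.
  + exact: represents_same rep same0.
  + exact: kept_same same0.
  + by split; tmpE.
- move=> i s1 lt_i [sg1 [w1 rep1 bd1 kept1 [a1 b1]]]; split.
    by rewrite a1 b1; lia.
  apply: reach_seq; apply: reach_copy; apply: reach_seq; rewrite b1.
  have rep1' : represents V (upd sg1 x 0 i) (setm s1 (adr x 0) i).
    move=> a j lt_a; rewrite /= adr_eq ?(ltnW lt_a) ?(ltnW lt_x) // /upd.
    by rewrite rep1.
  have bd1' : bounded B (upd sg1 x 0 i) by apply: bounded_upd => //; lia.
  move: w1; rewrite -(subnSK lt_i) /= => w1.
  apply: reach_weaken (Hc d.+2 _ _ _ bd1' rep1' w1) (leqnn _) _.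
  move=> s2 [sg2 [w2 rep2 bd2 kept2]]; apply: reach_succ.
  have E1 : rmem s2 (tmp d.+1) = i.
    by rewrite kept2 //= tmp_adr.
  rewrite E1; exists sg2; split=> //.
  + by move=> a j lt_a /=; rewrite adr_tmp // rep2.
  + by move=> t lt_t /=; tmpE; rewrite kept2 /= ?tmp_adr ?kept1 //; lia.
  by split; tmpE; rewrite kept2 //= tmp_adr.
- by move=> s1 [sg1 [_ _ _ _ [-> ->]]].
- move=> s1 [sg1 [w1 rep1 bd1 kept1 _]]; exists sg1; split=> //.
  by move: w1; rewrite subnn.
Qed.

(** [T] is fixed by the syntax before [B] is given: a loop multiplies the time of its body by at
    most [B], and loops are nested to a fixed depth. *)
Lemma ccmd_sound c : wf_cmd c -> exists2 T, poly_bounded T &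
  forall B d s (Q : post) sg, bounded B sg -> represents V sg s ->
  wp B c Q sg (rin s) (rout s) -> reach (T B) (ccmd c d) s (simulates B d Q s).
Proof.
elim: c => [a e1 e2|a|e|c1 IH1 c2 IH2|e c IH|x e c IH] /=.
- move=> /and3P[lt_a /(@cexpr_sound V)[T1 pT1 H1] /(@cexpr_sound V)[T2 pT2 H2]].
  have [F pF HF] := ev_bound e1.
  exists (fun B => T2 B + (T1 B + ((F B * (V + 5) + 3) + 1))) => [|B d s Q sg bd rep [le_B w]].
    by poly_tac.
  apply: reach_seq; apply: reach_weaken (H2 B sg d s bd rep) (leqnn _) _.
  move=> s1 [in1 out1 same1 v1]; have rep1 := represents_same rep same1.
  apply: reach_seq; apply: reach_weaken (H1 B sg d.+1 s1 bd rep1) (leqnn _) _.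
  move=> s2 [in2 out2 same2 v2]; have rep2 := represents_same rep1 same2.
  apply: reach_seq.
  apply: (reach_weaken (T := rmem s2 (tmp d.+1) * (V + 5) + 3)); last by move=> s3; exact.
    apply: reach_addr => s3 in3 out3 v3 m3; apply: reach_store.
    rewrite v3 v2.
    have E1 : rmem s3 (tmp d) = ev sg e2.
      by rewrite m3 ?(same_below_tmp same2) ?tmp_eq //; lia.
    exists (upd sg a (ev sg e1) (ev sg e2)); rewrite /= in3 in2 in1 out3 out2 out1.
    split=> //; last 1 first.
    + move=> t lt_t; rewrite /= tmp_adr // m3 ?tmp_eq; try lia.
      by rewrite (same_below_tmp same2) ?(same_below_tmp same1) //; lia.
    + move=> b j lt_b; rewrite /= adr_eq ?(ltnW lt_b) ?(ltnW lt_a) // /upd E1.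
      by rewrite m3 ?adr_tmp // rep2.
    + exact: bounded_upd.
  by rewrite v2 leq_add2r leq_mul2r HF ?orbT.
- move=> lt_a; exists (fun=> 1) => [|B d s Q sg bd rep [le_B w]]; first exact: poly_cst.
  apply: reach_read; exists (upd sg a 0 (head 0 (rin s))); split=> //.
  + by move=> b j lt_b; rewrite /= adr_eq ?(ltnW lt_b) ?(ltnW lt_a) // /upd rep.
  + exact: bounded_upd.
  + by move=> t lt_t; rewrite /= tmp_adr.
- move=> /(@cexpr_sound V)[T pT HT].
  exists (fun B => T B + 1) => [|B d s Q sg bd rep w]; first by poly_tac.
  apply: reach_seq; apply: reach_weaken (HT B sg d s bd rep) (leqnn _) _.
  move=> s1 [in1 out1 same1 v1]; apply: reach_write; exists sg.
  rewrite /= in1 out1 v1; split=> //; first exact: represents_same rep same1.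
  exact: kept_same same1.
- move=> /andP[/IH1[T1 pT1 H1] /IH2[T2 pT2 H2]].
  exists (fun B => T1 B + T2 B) => [|B d s Q sg bd rep w]; first by poly_tac.
  apply: reach_seq; apply: reach_weaken (H1 B d s _ sg bd rep w) (leqnn _) _.
  move=> s1 [sg1 [w1 rep1 bd1 k1]].
  apply: reach_weaken (H2 B d s1 _ sg1 bd1 rep1 w1) (leqnn _) _ => s2.
  exact: simulates_trans.
- move=> /andP[/(@cexpr_sound V)[T1 pT1 H1] /IH[T2 pT2 H2]].
  exists (fun B => T1 B + (1 + (T2 B + 1))) => [|B d s Q sg bd rep w]; first by poly_tac.
  apply: reach_seq; apply: reach_weaken (H1 B sg d s bd rep) (leqnn _) _.
  move=> s1 [in1 out1 same1 v1]; have rep1 := represents_same rep same1.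
  apply: reach_seq; apply: reach_set; rewrite addn1.
  set s2 := setm _ _ _.
  have same2 : same_below V d s1 s2 by apply: same_below_setm.
  have rep2 := represents_same rep1 same2.
  have k2 : kept d s s2 by apply: kept_trans (kept_same same1) (kept_same same2).
  have E0 : rmem s2 (tmp d) = ev sg e by rewrite -v1; tmpE.
  have E1 : rmem s2 (tmp d.+1) = 0 by tmpE.
  apply: reach_ifne; rewrite E0 E1 => /eqP Ev; move: w; rewrite ?Ev ?(negPf Ev) => w.
    by exists sg; rewrite /= in1 out1; split.
  rewrite -in1 -out1 in w.
  apply: reach_weaken (H2 B d s2 _ sg bd rep2 w) (leqnn _) _ => s3.
  exact: simulates_trans.
- move=> /and3P[lt_x /(@cexpr_sound V)[T1 pT1 H1] /IH[T2 pT2 H2]].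
  exists (fun B => T1 B + (B * (T2 B + 4) + 2)) => [|B d s Q sg bd rep [le_B w]].
    by poly_tac.
  apply: reach_seq; apply: reach_weaken (H1 B sg d s bd rep) (leqnn _) _.
  move=> s1 [in1 out1 same1 v1]; have rep1 := represents_same rep same1.
  rewrite -in1 -out1 in w.
  apply: reach_weaken.
  + by apply: (ccmd_for (w := wp B c)) bd rep1 lt_x v1 le_B _ w; apply: H2.
  + by rewrite leq_add2r leq_mul2r le_B orbT.
  by move=> s2; apply: simulates_trans (kept_same same1).
Qed.

End CompileCmd.

(** The initial memory represents the zero store. Since [T] depends on the program alone, it bounds
    the time on all inputs at once. *)
Lemma cmd_program V c : wf_cmd V c -> exists2 T, poly_bounded T &
  forall B x (Q : seq nat -> Prop),
  wp B c (fun _ _ out => Q out) (fun _ _ => 0) x [::] ->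
  exists t y, [/\ t <= T B, computes_within (ccmd V c 0 0) x t y & Q y].
Proof.
move=> /ccmd_sound[T pT H]; exists T => // B x Q w.
have {}H := H B 0 (RState (fun=> 0) x [::]) (fun _ _ out => Q out) (fun _ _ => 0)
  (fun _ _ => leq0n B) (fun _ _ _ => erefl) w.
have [t [s [le_t run [sg [Qs _ _ _]]]]] := reach_halt H.
by exists t, (rout s).
Qed.

(** * The frame rule and the rule for loops *)

Fixpoint mods c : seq nat :=
  match c with
  | Store a _ _ => [:: a]
  | Read a => [:: a]
  | Write _ => [::]
  | Seq c1 c2 => mods c1 ++ mods c2
  | If _ c => mods c
  | For x _ c => x :: mods c
  end.

Definition same_outside (l : seq nat) (sg sg' : store) :=
  forall a, a \notin l -> sg' a =1 sg a.

Lemma same_outside_trans l sg1 sg2 sg3 :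
  same_outside l sg1 sg2 -> same_outside l sg2 sg3 -> same_outside l sg1 sg3.
Proof. by move=> H1 H2 a Na i; rewrite H2 ?H1. Qed.

Lemma same_outside_sub (l l' : seq nat) sg sg' :
  {subset l <= l'} -> same_outside l sg sg' -> same_outside l' sg sg'.
Proof. by move=> sub H a Na; apply: H; apply: contra Na => /sub. Qed.

Lemma same_outside_upd l sg a i v : a \in l -> same_outside l sg (upd sg a i v).
Proof.
move=> la b Nb j; rewrite /upd; case: eqP => //= Eb.
by rewrite Eb la in Nb.
Qed.

Definition framed l sg (Q : post) : post := fun sg' inp out =>
  Q sg' inp out /\ same_outside l sg sg'.

Lemma wp_mono B c (Q Q' : post) : (forall sg inp out, Q sg inp out -> Q' sg inp out) ->
  forall sg inp out, wp B c Q sg inp out -> wp B c Q' sg inp out.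
Proof.
elim: c Q Q' => [a e1 e2|a|e|c1 IH1 c2 IH2|e c IH|x e c IH] Q Q' QQ' sg inp out /=.
- by move=> [? ?]; split=> //; apply: QQ'.
- by move=> [? ?]; split=> //; apply: QQ'.
- exact: QQ'.
- by apply: IH1; apply: IH2.
- by case: eqP => _; [apply: QQ' | apply: IH].
- move=> [le_B H]; split=> //; move: (ev sg e) {le_B} H => n.
  elim: n 0 sg inp out => [|n IHn] i sg inp out /=.
    exact: QQ'.
  by apply: IH => sg' inp' out'; apply: IHn.
Qed.

(** Arrays that a command never assigns keep their values, a fact read off the syntax. Comparing
    with an earlier store [sg0] lets the conclusion pass through sequences and rounds of a loop. *)
Lemma wp_frame B c l sg0 (Q : post) sg inp out : {subset mods c <= l} ->
  same_outside l sg0 sg -> wp B c Q sg inp out ->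
  wp B c (framed l sg0 Q) sg inp out.
Proof.
elim: c Q sg inp out => [a e1 e2|a|e|c1 IH1 c2 IH2|e c IH|x e c IH] Q sg inp out /= sub same.
- move=> [? ?]; split=> //; split=> //; apply: same_outside_trans same _.
  by apply/same_outside_upd/sub/mem_head.
- move=> [? ?]; split=> //; split=> //; apply: same_outside_trans same _.
  by apply/same_outside_upd/sub/mem_head.
- by split.
- move=> H; have H1 : {subset mods c1 <= l} by move=> a Ha; apply: sub; rewrite mem_cat Ha.
  have H2 : {subset mods c2 <= l} by move=> a Ha; apply: sub; rewrite mem_cat Ha orbT.
  apply: wp_mono (IH1 _ _ _ _ H1 same H) => sg' inp' out' [w same'].
  exact: IH2.
- by case: eqP => _ w; [split | apply: IH].
- move=> [le_B H]; split=> //.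
  have subc : {subset mods c <= l} by move=> a Ha; apply: sub; rewrite inE Ha orbT.
  move: (ev sg e) {le_B} H => n.
  elim: n 0 sg inp out same => [|n IHn] i sg inp out same /= w; first by split.
  have same1 : same_outside l sg0 (upd sg x 0 i).
    by apply: same_outside_trans same _; apply/same_outside_upd/sub/mem_head.
  apply: wp_mono (IH _ _ _ _ subc same1 w) => sg' inp' out' [w' same'].
  exact: IHn.
Qed.

(** The frame rule is built in: an invariant has to mention only what the loop changes, the rest
    comes from [same_outside]. *)
Lemma wp_for B x e c (Inv : nat -> post) (Q : post) sg inp out :
  ev sg e <= B -> Inv 0 sg inp out ->
  (forall i sg' inp' out', i < ev sg e -> same_outside (x :: mods c) sg sg' ->
     Inv i sg' inp' out' -> wp B c (Inv i.+1) (upd sg' x 0 i) inp' out') ->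
  (forall sg' inp' out', same_outside (x :: mods c) sg sg' ->
     Inv (ev sg e) sg' inp' out' -> Q sg' inp' out') ->
  wp B (For x e c) Q sg inp out.
Proof.
move=> le_B I0 Hc HQ; split=> //.
set n := ev sg e in Hc HQ *.
have H j i sg' inp' out' : i + j = n -> framed (x :: mods c) sg (Inv i) sg' inp' out' ->
    wp_loop (wp B c) x i j Q sg' inp' out'.
  elim: j i sg' inp' out' => [|j IHj] i sg' inp' out' En [Ii same] /=.
    by rewrite addn0 in En; apply: HQ => //; rewrite -En.
  have lt_i : i < n by lia.
  have same' : same_outside (x :: mods c) sg (upd sg' x 0 i).
    by apply: same_outside_trans same _; apply: same_outside_upd; apply: mem_head.
  have sub : {subset mods c <= x :: mods c} by move=> a Ha; rewrite inE Ha orbT.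
  apply: wp_mono (wp_frame sub same' (Hc i sg' inp' out' lt_i same Ii)) => sg2 inp2 out2.
  by apply: IHj; rewrite addSnnS.
by apply: H => //; split.
Qed.

Lemma wp_if B e c (Q : post) sg inp out :
  (ev sg e != 0 -> wp B c Q sg inp out) -> (ev sg e = 0 -> Q sg inp out) ->
  wp B (If e c) Q sg inp out.
Proof. by move=> H1 H0 /=; case: eqP => [/H0|/eqP/H1]. Qed.

(** * The dynamic program *)

Definition bit s j := odd (s %/ 2 ^ j).

(** Binary representation, least significant bit first. Sets of resources and sets of constraints
    become numbers, which loops can run through. *)
Fixpoint enc L (f : nat -> bool) : nat :=
  if L is L'.+1 then f 0 + (enc L' (f \o succn)).*2 else 0.

Lemma enc_lt L f : enc L f < 2 ^ L.
Proof.
elim: L f => //= L IHL f; rewrite expnS mul2n.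
have := IHL (f \o succn); case: (f 0); lia.
Qed.

Lemma bit_enc L f j : j < L -> bit (enc L f) j = f j.
Proof.
rewrite /bit; elim: L f j => //= L IHL f [_|j lt_j].
  by rewrite divn1 oddD odd_double addbF oddb.
rewrite expnS divnMA divn2 half_bit_double; exact: IHL.
Qed.

(* The instance is given by the lists [ls] of the resources of each user, the
   number [k] of resources and the list [cs] of the constraints [(t, a, b)],
   where [t = 0] for BoD_E and [t = 1] for SoD_U; [con] adds the requirement
   that each resource has a user as a constraint BoD_E with [a = b]. *)
Section DynamicProgram.

Variables (ls : seq (seq nat)) (k : nat) (cs : seq (nat * nat * nat)).

Let m := size ls.
Let L := k + size cs.

Definition con j := if j < k then (0, j, j) else nth (0, 0, 0) cs (j - k).

Definition solution (S : nat -> nat -> bool) :=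
  [/\ forall i r, i < m -> r < k -> S i r -> r \in nth [::] ls i,
      forall j, j < L -> (con j).1.1 = 0 ->
        exists2 i, i < m & S i (con j).1.2 && S i (con j).2
    & forall j i, j < L -> (con j).1.1 != 0 -> i < m ->
        ~~ (S i (con j).1.2 && S i (con j).2)].

Definition cov S j := bit S (con j).1.2 && bit S (con j).2.

Definition good i S :=
  all (fun r => bit S r ==> (r \in nth [::] ls i)) (iota 0 k).

(** Two resources have disjoint sets of users exactly when no single user has both, so SoD_U is
    tested user by user. *)
Definition nosod S := all (fun j => ((con j).1.1 != 0) ==> ~~ cov S j) (iota 0 L).

Definition covers S s s' :=
  all (fun j => bit s j ==> bit s' j || cov S j) (iota 0 L).

Definition trans i S s s' := [&& good i S, nosod S & covers S s s'].

(* [ok v s]: the last [v] users can satisfy the BoD_E constraints in the set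
   encoded by [s]; SoD_U constraints in [s] are ignored. *)
Fixpoint ok v s :=
  if v is v'.+1 then
    has (fun S => has (fun s' => trans (m - 1 - v') S s s' && ok v' s')
                      (iota 0 (2 ^ L))) (iota 0 (2 ^ k))
  else all (fun j => bit s j ==> ((con j).1.1 != 0)) (iota 0 L).

Lemma con_lt j : (forall c, c \in cs -> c.1.2 < k /\ c.2 < k) ->
  j < L -> (con j).1.2 < k /\ (con j).2 < k.
Proof.
move=> Hcs lt_j; rewrite /con; case: ifP => // Hj.
by apply/Hcs/mem_nth; rewrite ltn_subLR // leqNgt Hj.
Qed.

(** Completeness of the recurrence, by following the given solution: the next user receives its set
    there, and the next state keeps exactly the constraints of [s] that this user does not cover. A
    user covering a kept BoD_E constraint is then a later one. *)
Lemma ok_solution S v s :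
  (forall c, c \in cs -> c.1.2 < k /\ c.2 < k) -> solution S -> v <= m ->
  (forall j, j < L -> bit s j -> (con j).1.1 = 0 ->
     exists2 i, m - v <= i < m & S i (con j).1.2 && S i (con j).2) ->
  ok v s.
Proof.
move=> Hcs [Sls _ Ssod]; elim: v s => [|v IHv] s le_v Hs.
  apply/allP => j; rewrite mem_iota /= => lt_j; apply/implyP => sj.
  apply/eqP => Ej; have [i] := Hs j lt_j sj Ej; lia.
set i0 := m - 1 - v.
have lt_i0 : i0 < m by rewrite /i0; lia.
pose X := enc k (S i0).
have covX j : j < L -> cov X j = S i0 (con j).1.2 && S i0 (con j).2.
  by move=> /(con_lt Hcs)[lta ltb]; rewrite /cov !bit_enc.
pose s' := enc L (fun j => bit s j && ~~ cov X j).
apply/hasP; exists X; first by rewrite mem_iota enc_lt.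
apply/hasP; exists s'; first by rewrite mem_iota enc_lt.
rewrite -/i0; apply/andP; split.
  apply/and3P; split; apply/allP => j; rewrite mem_iota /= add0n => lt_j.
  - by rewrite bit_enc //; apply/implyP; apply: Sls.
  - by rewrite covX //; apply/implyP => Hj; apply: Ssod.
  - by rewrite bit_enc //; case: (bit s j); case: (cov X j).
apply: IHv => [|j lt_j]; first exact: ltnW.
rewrite bit_enc // covX // => /andP[sj Nj] Ej.
have [i le_i Si] := Hs j lt_j sj Ej; exists i => //.
have Ni : i != i0 by apply: contraNneq Nj => <-.
by rewrite /i0 in Ni; lia.
Qed.

(** The initial state, with all [L] bits set. It may include the bits of SoD_U constraints because
    [ok] ignores them. *)
Definition all_needed := 2 ^ L - 1.

Lemma bit_all_needed j : j < L -> bit all_needed j.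
Proof.
have -> : all_needed = enc L xpredT.
  rewrite /all_needed; elim: {j} L => //= n IHn; rewrite expnS.
  have := expn_gt0 2 n; change (xpredT \o succn) with (xpredT : pred nat); lia.
by move=> lt_j; rewrite bit_enc.
Qed.

Definition used S := [seq r <- iota 0 k | S r].
Definition encode_users (n : nat) (S : nat -> nat -> bool) :=
  flatten [seq size (used (S i)) :: used (S i) | i <- iota 0 n].

Definition correct_output out :=
  (exists2 S, solution S & out = 1 :: encode_users m S) \/
  ~ (exists S, solution S) /\ out = [:: 0].

(* The output phase after [i] users, which were given the sets [f]. *)
Definition partial f i s :=
  [/\ forall i', i' < i -> good i' (f i') && nosod (f i'),
      forall j, j < L -> (con j).1.1 = 0 -> bit s j \/ exists2 i', i' < i & cov (f i') j
    & ok (m - i) s].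

Lemma partial0 s : ok m s -> (forall j, j < L -> bit s j) -> partial (fun=> 0) 0 s.
Proof. by move=> oks Hs; split; rewrite ?subn0 // => j lt_j _; left; apply: Hs. Qed.

Lemma ok_step i s : i < m -> ok (m - i) s ->
  exists2 S, S < 2 ^ k & exists2 s', s' < 2 ^ L &
    trans i S s s' && ok (m - 1 - i) s'.
Proof.
move=> lt_i; rewrite (_ : m - i = (m - 1 - i).+1); last by lia.
move=> /= /hasP[S]; rewrite mem_iota => lt_S /hasP[s']; rewrite mem_iota => lt_s'.
by rewrite (_ : m - 1 - (m - 1 - i) = i); [exists S => //; exists s'|lia].
Qed.

Lemma partial_step f i s S s' : i < m -> partial f i s ->
  trans i S s s' -> ok (m - 1 - i) s' ->
  partial (fun x => if x == i then S else f x) i.+1 s'.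
Proof.
move=> lt_i [Hf Hs _] /and3P[goodS sodS covS] oks'; split.
- move=> i'; rewrite ltnS leq_eqVlt; case: eqP => [->|_] /= lt_i'; first by rewrite goodS.
  exact: Hf.
- move=> j lt_j Ej; have [sj|[i' lt_i' ci']] := Hs j lt_j Ej.
    have := allP covS j; rewrite mem_iota sj => /(_ lt_j) /orP[|cj]; first by left.
    by right; exists i; rewrite ?eqxx.
  by right; exists i'; rewrite ?(ltn_eqF lt_i') // ltnS ltnW.
- by rewrite (_ : m - i.+1 = m - 1 - i) //; lia.
Qed.

(** When no user is left, [ok] says that the state contains no BoD_E constraint. Each of them is
    therefore covered by one of the sets already chosen. *)
Lemma partial_solution f s : partial f m s -> solution (fun i => bit (f i)).
Proof.
move=> [Hf Hs]; rewrite subnn /= => /allP oks; split.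
- move=> i r lt_i lt_r; have /andP[/allP/(_ r)] := Hf i lt_i.
  by rewrite mem_iota => /(_ lt_r)/implyP.
- move=> j lt_j Ej; have [sj|//] := Hs j lt_j Ej.
  by have := oks j; rewrite mem_iota sj Ej => /(_ lt_j).
- move=> j i lt_j Nj lt_i; have /andP[_ /allP/(_ j)] := Hf i lt_i.
  by rewrite mem_iota => /(_ lt_j)/implyP/(_ Nj).
Qed.

End DynamicProgram.

Arguments wp : simpl never.

Section WpRules.

Variables (B : nat) (Q : post) (sg : store) (inp out : seq nat).

Lemma wp_seq c1 c2 : wp B c1 (wp B c2 Q) sg inp out -> wp B (Seq c1 c2) Q sg inp out.
Proof. by []. Qed.

Lemma wp_store a e1 e2 : ev sg e2 <= B ->
  Q (upd sg a (ev sg e1) (ev sg e2)) inp out -> wp B (Store a e1 e2) Q sg inp out.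
Proof. by []. Qed.

Lemma wp_read a w inp' : inp = w :: inp' -> w <= B ->
  Q (upd sg a 0 w) inp' out -> wp B (Read a) Q sg inp out.
Proof. by rewrite /wp => ->. Qed.

Lemma wp_write e : Q sg inp (rcons out (ev sg e)) -> wp B (Write e) Q sg inp out.
Proof. by []. Qed.

End WpRules.

(** * Logical formulas as expressions *)

Definition Var x := Get x (Cst 0).
Definition Not e := Monus (Cst 1) e.
Definition And e1 e2 := Times e1 e2.
Definition Or e1 e2 := Not (And (Not e1) (Not e2)).
Definition Imp e1 e2 := Not (And e1 (Not e2)).
Definition Leq e1 e2 := Not (Monus e1 e2).
Definition All x n e := Not (Sum x n (Not e)).

(** Truth is being nonzero rather than being 1, since [Sum] adds up over all witnesses. *)
Definition holds sg e := ev sg e != 0.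

Lemma ev_not sg e : ev sg (Not e) = ~~ holds sg e.
Proof. by rewrite /holds /=; case: (ev sg e) => [|n]; rewrite ?subSS ?sub0n. Qed.

Lemma holds_not sg e : holds sg (Not e) = ~~ holds sg e.
Proof. by rewrite {1}/holds ev_not; case: holds. Qed.

Lemma holds_and sg e1 e2 : holds sg (And e1 e2) = holds sg e1 && holds sg e2.
Proof. by rewrite /holds /= muln_eq0 negb_or. Qed.

Lemma holds_or sg e1 e2 : holds sg (Or e1 e2) = holds sg e1 || holds sg e2.
Proof. by rewrite holds_not holds_and !holds_not negb_and !negbK. Qed.

Lemma holds_imp sg e1 e2 : holds sg (Imp e1 e2) = (holds sg e1 ==> holds sg e2).
Proof. by rewrite holds_not holds_and holds_not negb_and negbK implybE. Qed.

Lemma ev_leq sg e1 e2 : ev sg (Leq e1 e2) = (ev sg e1 <= ev sg e2).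
Proof. by rewrite ev_not /holds /= subn_eq0 negbK. Qed.

Lemma holds_sum sg x n e :
  holds sg (Sum x n e) = has (fun i => holds (upd sg x 0 i) e) (iota 0 (ev sg n)).
Proof.
rewrite /holds /=; elim: (iota _ _) => [|i r IHr]; first by rewrite big_nil.
by rewrite big_cons addn_eq0 negb_and IHr.
Qed.

Lemma holds_all sg x n e :
  holds sg (All x n e) = all (fun i => holds (upd sg x 0 i) e) (iota 0 (ev sg n)).
Proof.
rewrite holds_not holds_sum -all_predC; apply: eq_all => i /=.
by rewrite holds_not negbK.
Qed.

(** Names in [v] are variables, names in [a] are arrays. [vm], [vk], [vn] hold the numbers of users,
    resources and constraints; [vi] is the current user, [vs] the current state, [vS] and [vt] are a
    candidate set and next state, [vbS] and [vbt] those found; [vh] is bound by [Bit]. [aBS] is the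
    base relation, [aCT], [aCA], [aCB] are the components of [con], and [aOK] is the table of
    [ok]. *)
Notation vm := 0 (only parsing).
Notation vk := 1 (only parsing).
Notation vn := 2 (only parsing).
Notation vi := 3 (only parsing).
Notation vq := 4 (only parsing).
Notation vc := 5 (only parsing).
Notation vr := 6 (only parsing).
Notation vj := 7 (only parsing).
Notation vv := 8 (only parsing).
Notation vs := 9 (only parsing).
Notation vS := 10 (only parsing).
Notation vt := 11 (only parsing).
Notation vbS := 12 (only parsing).
Notation vbt := 13 (only parsing).
Notation vh := 14 (only parsing).
Notation aBS := 15 (only parsing).
Notation aCT := 16 (only parsing).
Notation aCA := 17 (only parsing).
Notation aCB := 18 (only parsing).
Notation aP2 := 19 (only parsing).
Notation aOK := 20 (only parsing).
Notation nvars := 21 (only parsing).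

(* [odd (s %/ 2 ^ j)] as the number of [h < s] such that
   [(2 h + 1) 2 ^ j <= s < (2 h + 2) 2 ^ j]; [aP2] is the table of the powers
   of two. *)
Definition Bit s j :=
  let mult c := Times (Plus (Times (Cst 2) (Var vh)) (Cst c)) (Get aP2 j) in
  Sum vh s (Monus (Leq (mult 1) s) (Leq (mult 2) s)).

Lemma sum_pred (P : pred nat) r : \sum_(i <- r) P i = count P r.
Proof. by elim: r => [|i r IHr]; rewrite ?big_nil // big_cons IHr. Qed.

(** With [x = s %/ 2 ^ j], a term counts iff [2 * h + 1 <= x < 2 * h + 2], which forces [h = x./2]
    and [x] odd. For odd [x] this [h] is below [x], hence below [s] and in the range of the sum. The
    first two hypotheses say that the arguments do not depend on the bound variable [vh]. *)
Lemma ev_bit sg s j :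
  (forall v, ev (upd sg vh 0 v) s = ev sg s) ->
  (forall v, ev (upd sg vh 0 v) j = ev sg j) ->
  sg aP2 (ev sg j) = 2 ^ ev sg j ->
  ev sg (Bit s j) = bit (ev sg s) (ev sg j).
Proof.
move=> Hs Hj EP; rewrite /Bit.
set x := ev sg s %/ 2 ^ ev sg j.
transitivity (\sum_(h <- iota 0 (ev sg s)) (odd x && (h == x./2))).
  rewrite [LHS]/=; apply: eq_bigr => h _.
  have leqE a b : 1 - (a - b) = (a <= b) := ev_leq sg (Cst a) (Cst b).
  rewrite !leqE !Hs !Hj.
  rewrite /upd /= EP.
  rewrite -!leq_divRL ?expn_gt0 // -/x.
  have := odd_double_half x; case: (odd x) => /= Ex.
    by case: eqP; case: leqP; case: leqP; lia.
  by case: leqP; case: leqP; lia.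
have le_x : x <= ev sg s by apply: leq_div.
rewrite /bit -/x; case: (boolP (odd x)) => Ox; last by rewrite big1.
rewrite sum_pred (eq_count (a2 := pred1 x./2)) // count_uniq_mem ?iota_uniq //.
suff lt_h : x./2 < ev sg s by rewrite mem_iota lt_h.
by have := odd_double_half x; rewrite Ox; lia.
Qed.

Definition L_expr := Plus (Var vk) (Var vn).
(** Expressions have no exponentiation, so powers are looked up. This one is the number of states
    and also the length of a row of [aOK]. *)
Definition W_expr := Get aP2 L_expr.
Definition K_expr := Get aP2 (Var vk).

Definition good_expr S := All vr (Var vk)
  (Imp (Bit S (Var vr)) (Get aBS (Plus (Times (Var vi) (Var vk)) (Var vr)))).
Definition cov_expr S := And (Bit S (Get aCA (Var vj))) (Bit S (Get aCB (Var vj))).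
Definition nosod_expr S :=
  All vj L_expr (Imp (Get aCT (Var vj)) (Not (cov_expr S))).
Definition covers_expr S s s' := All vj L_expr
  (Imp (Bit s (Var vj)) (Or (Bit s' (Var vj)) (cov_expr S))).
Definition ok_expr v s := Get aOK (Plus (Times v W_expr) s).
Definition step_expr :=
  And (And (good_expr (Var vS))
           (And (nosod_expr (Var vS)) (covers_expr (Var vS) (Var vs) (Var vt))))
      (ok_expr (Var vv) (Var vt)).

Section Data.

Variables (ls : seq (seq nat)) (k : nat) (cs : seq (nat * nat * nat)).
Hypothesis cs_lt : forall c, c \in cs -> [/\ c.1.1 <= 1, c.1.2 < k & c.2 < k].

Notation m := (size ls).
Notation L := (k + size cs).
Notation con := (con k cs).

Record data (sg : store) : Prop := Data {
  data_m : sg vm 0 = m;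
  data_k : sg vk 0 = k;
  data_n : sg vn 0 = size cs;
  data_BS : forall i r, i < m -> r < k ->
    sg aBS (i * k + r) = (r \in nth [::] ls i);
  data_CT : forall j, j < L -> sg aCT j = (con j).1.1;
  data_CA : forall j, j < L -> sg aCA j = (con j).1.2;
  data_CB : forall j, j < L -> sg aCB j = (con j).2;
  data_P2 : forall j, j <= L -> sg aP2 j = 2 ^ j
}.

Definition data_names := [:: vm; vk; vn; aBS; aCT; aCA; aCB; aP2].

(** Once the input has been read, no phase assigns to [data_names], so the facts about the instance
    survive by a syntactic check. *)
Lemma data_same l sg sg' : all (fun a => a \notin l) data_names ->
  same_outside l sg sg' -> data sg -> data sg'.
Proof.
move=> /allP Hl same [Hm Hk Hn HBS HCT HCA HCB HP2].
have E a i : a \in data_names -> sg' a i = sg a i by move=> /Hl Ha; apply: same.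
split=> *; by rewrite E // ?Hm ?Hk ?Hn ?HBS ?HCT ?HCA ?HCB ?HP2.
Qed.

Lemma data_upd a i v sg : a \notin data_names -> data sg -> data (upd sg a i v).
Proof.
move=> Na; apply: (@data_same [:: a]); last exact/same_outside_upd/mem_head.
by apply/allP => b Hb; rewrite inE; apply: contraNneq Na => <-.
Qed.

Lemma ev_L sg : data sg -> ev sg L_expr = L.
Proof. by move=> D; rewrite /= (data_k D) (data_n D). Qed.

Lemma ev_W sg : data sg -> ev sg W_expr = 2 ^ L.
Proof.
by move=> D; rewrite /W_expr [LHS]/= -/L_expr (data_k D) (data_n D) (data_P2 D).
Qed.

Lemma ev_K sg : data sg -> ev sg K_expr = 2 ^ k.
Proof. by move=> D; rewrite /= (data_k D) (data_P2 D) // leq_addr. Qed.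

Lemma holds_bit sg x j : data sg -> x != vh ->
  (forall v, ev (upd sg vh 0 v) j = ev sg j) -> ev sg j <= L ->
  holds sg (Bit (Var x) j) = bit (sg x 0) (ev sg j).
Proof.
move=> D Nx Hj le_j; rewrite /holds ev_bit ?(data_P2 D) //; last first.
  by move=> v; rewrite /= /upd (negPf Nx).
by rewrite eqb0 negbK.
Qed.

Lemma con_bound j : j < L -> [/\ (con j).1.1 <= 1, (con j).1.2 < k & (con j).2 < k].
Proof.
move=> lt_j; rewrite /con; case: ifP => // Hj.
by apply/cs_lt/mem_nth; rewrite ltn_subLR // leqNgt Hj.
Qed.

Lemma holds_good sg x : data sg -> sg vi 0 < m -> x \notin [:: vr; vh] ->
  holds sg (good_expr (Var x)) = good ls k (sg vi 0) (sg x 0).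
Proof.
rewrite !inE negb_or => D lt_i /andP[Nr Nh]; rewrite holds_all /good /= (data_k D).
apply: eq_in_all => r; rewrite mem_iota /= add0n => lt_r.
have D' : data (upd sg vr 0 r) by apply: data_upd.
rewrite holds_imp holds_bit //= ?(leq_trans (ltnW lt_r)) ?leq_addr //.
by rewrite /upd /= (negPf Nr) /holds /= (data_k D) (data_BS D) // eqb0 negbK.
Qed.

Lemma holds_cov sg x : data sg -> x != vh -> sg vj 0 < L ->
  holds sg (cov_expr (Var x)) = cov k cs (sg x 0) (sg vj 0).
Proof.
move=> D Nx lt_j; have [_ lta ltb] := con_bound lt_j.
have EA : ev sg (Get aCA (Var vj)) = (con (sg vj 0)).1.2 by apply: data_CA.
have EB : ev sg (Get aCB (Var vj)) = (con (sg vj 0)).2 by apply: data_CB.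
by rewrite holds_and !holds_bit ?EA ?EB //; lia.
Qed.

Lemma holds_nosod sg x : data sg -> x \notin [:: vj; vh] ->
  holds sg (nosod_expr (Var x)) = nosod k cs (sg x 0).
Proof.
rewrite !inE negb_or => D /andP[Nj Nh]; rewrite holds_all (ev_L D).
apply: eq_in_all => j; rewrite mem_iota /= add0n => lt_j.
have D' : data (upd sg vj 0 j) by apply: data_upd.
rewrite holds_imp holds_not holds_cov // /upd /= (negPf Nj).
by rewrite /holds /= (data_CT D).
Qed.

Lemma holds_covers sg x y z : data sg ->
  x \notin [:: vj; vh] -> y \notin [:: vj; vh] -> z \notin [:: vj; vh] ->
  holds sg (covers_expr (Var x) (Var y) (Var z))
  = covers k cs (sg x 0) (sg y 0) (sg z 0).
Proof.
rewrite !inE !negb_or => D /andP[Nx Nx'] /andP[Ny Ny'] /andP[Nz Nz'].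
rewrite holds_all (ev_L D).
apply: eq_in_all => j; rewrite mem_iota /= add0n => lt_j.
have D' : data (upd sg vj 0 j) by apply: data_upd.
rewrite holds_imp holds_or holds_cov // !holds_bit //=; try exact: ltnW.
by rewrite /upd /= (negPf Nx) (negPf Ny) (negPf Nz).
Qed.

Definition ok_rows v (sg : store) := forall v' s, v' < v -> s < 2 ^ L ->
  sg aOK (v' * 2 ^ L + s) = ok ls k cs v' s.

Lemma holds_step sg : data sg -> sg vi 0 < m -> ok_rows (sg vv 0).+1 sg ->
  sg vt 0 < 2 ^ L ->
  holds sg step_expr =
  trans ls k cs (sg vi 0) (sg vS 0) (sg vs 0) (sg vt 0)
  && ok ls k cs (sg vv 0) (sg vt 0).
Proof.
move=> D lt_i Hok lt_t; rewrite !holds_and holds_good // holds_nosod // holds_covers //.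
congr (_ && _); rewrite /holds /ok_expr [ev _ _]/= -[_ aP2 _]/(ev sg W_expr) ev_W //.
by rewrite Hok // eqb0 negbK.
Qed.

End Data.

(** * The program *)

Definition read_base :=
  For vi (Var vm) (Seq (Read vc) (For vq (Var vc)
    (Seq (Read vr)
         (Store aBS (Plus (Times (Var vi) (Var vk)) (Var vr)) (Cst 1))))).

(** The types in [aCT] keep their initial value 0, which is the code of BoD_E. *)
Definition add_completeness :=
  For vj (Var vk) (Seq (Store aCA (Var vj) (Var vj)) (Store aCB (Var vj) (Var vj))).

Definition read_constraint_word a :=
  Seq (Read vr) (Store a (Plus (Var vk) (Var vj)) (Var vr)).

Definition read_constraints :=
  For vj (Var vn) (Seq (read_constraint_word aCT)
    (Seq (read_constraint_word aCA) (read_constraint_word aCB))).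

Definition powers :=
  Seq (Store aP2 (Cst 0) (Cst 1))
    (For vj L_expr (Store aP2 (Plus (Var vj) (Cst 1))
      (Plus (Get aP2 (Var vj)) (Get aP2 (Var vj))))).

Definition setup :=
  Seq (Read vm) (Seq (Read vk) (Seq (Read vn)
    (Seq read_base (Seq add_completeness (Seq read_constraints powers))))).

Definition first_row :=
  For vs W_expr (Store aOK (Var vs)
    (All vj L_expr (Imp (Bit (Var vs) (Var vj)) (Get aCT (Var vj))))).

(** Row [vv + 1] puts the user [m - 1 - vv] in front of the users of row [vv]. The double negation
    turns the sum over all pairs into a truth value 0 or 1, as the table requires. *)
Definition next_rows :=
  For vv (Var vm)
    (Seq (Store vi (Cst 0) (Monus (Monus (Var vm) (Cst 1)) (Var vv)))
      (For vs W_expr (Store aOK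
        (Plus (Times (Plus (Var vv) (Cst 1)) W_expr) (Var vs))
        (Not (Not (Sum vS K_expr (Sum vt W_expr step_expr))))))).

(** A loop cannot be left early, so all pairs are tried and the last successful one is kept. *)
Definition find_step :=
  For vS K_expr (For vt W_expr (If step_expr
    (Seq (Store vbS (Cst 0) (Var vS)) (Store vbt (Cst 0) (Var vt))))).

Definition write_user :=
  Seq (Write (Sum vr (Var vk) (Bit (Var vbS) (Var vr))))
    (For vr (Var vk) (If (Bit (Var vbS) (Var vr)) (Write (Var vr)))).

Definition write_solution :=
  Seq (Write (Cst 1)) (Seq (Store vs (Cst 0) (Monus W_expr (Cst 1)))
    (For vi (Var vm)
      (Seq (Store vv (Cst 0) (Monus (Monus (Var vm) (Cst 1)) (Var vi)))
        (Seq find_step (Seq write_user (Store vs (Cst 0) (Var vbt))))))).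

Definition solvable_expr := ok_expr (Var vm) (Monus W_expr (Cst 1)).

(** There is no else branch: the test is repeated in negated form. Its value has not changed,
    because writing a solution modifies neither the instance nor the table. *)
Definition apep_cmd :=
  Seq setup (Seq first_row (Seq next_rows
    (Seq (If solvable_expr write_solution)
         (If (Not solvable_expr) (Write (Cst 0)))))).

Lemma wf_apep_cmd : wf_cmd nvars apep_cmd.
Proof. by []. Qed.

(** * Correctness of the program *)

Section Correctness.

Variables (ls : seq (seq nat)) (k : nat) (cs : seq (nat * nat * nat)) (B : nat).
Hypothesis ls_lt : forall l r, l \in ls -> r \in l -> r < k.
Hypothesis cs_lt : forall c, c \in cs -> [/\ c.1.1 <= 1, c.1.2 < k & c.2 < k].

Notation m := (size ls).
Notation L := (k + size cs).
Notation con := (con k cs).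

Hypothesis le_m : m <= B.
Hypothesis le_ls : forall l, l \in ls -> size l <= B.
Hypothesis le_L : 2 ^ L <= B.

Lemma L_le_B : L <= B.
Proof. exact: leq_trans (ltnW (ltn_expl _ _)) le_L. Qed.

Definition list_words (l : seq nat) := size l :: l.
Definition constraint_words (c : nat * nat * nat) := [:: c.1.1; c.1.2; c.2].
Definition input_words :=
  [:: m; k; size cs] ++ flatten [seq list_words l | l <- ls]
    ++ flatten [seq constraint_words c | c <- cs].

(** Division with remainder by [k] recovers user and resource from the flat index [x]. [done]
    contains the lists read completely, [l] the part read of the next one. *)
Definition BS_holds (done : seq (seq nat)) (l : seq nat) (sg : store) := forall x,
  sg aBS x = (x %% k \in nth [::] done (x %/ k))
    || (x %/ k == size done) && (x %% k \in l).

Lemma wp_read_base Q sg rest out : sg vm 0 = m -> sg vk 0 = k ->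
  (forall x, sg aBS x = 0) ->
  (forall sg', same_outside (mods read_base) sg sg' ->
     BS_holds ls [::] sg' -> Q sg' rest out) ->
  wp B read_base Q sg (flatten [seq list_words l | l <- ls] ++ rest) out.
Proof.
move=> Em Ek E0 HQ.
apply: (@wp_for _ _ _ _ (fun i sg' inp' out' =>
  [/\ inp' = flatten [seq list_words l | l <- drop i ls] ++ rest, out' = out
    & BS_holds (take i ls) [::] sg'])).
- by rewrite /= Em.
- rewrite drop0 take0; split=> // x.
  by rewrite E0 nth_nil in_nil andbF.
- rewrite [ev _ _]/= Em => i sg1 inp1 out1 lt_i same1 [-> -> H1].
  set l := nth [::] ls i.
  have l_ls : l \in ls by apply: mem_nth.
  have size_t : size (take i ls) = i by rewrite size_takel // ltnW.
  rewrite (drop_nth [::] lt_i) -/l map_cons /= -catA.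
  apply: wp_seq; apply: wp_read; first by [].
    exact: le_ls.
  apply: (@wp_for _ _ _ _ (fun q sg' inp' out' =>
    [/\ inp' = drop q l ++ flatten [seq list_words l | l <- drop i.+1 ls] ++ rest,
        out' = out & BS_holds (take i ls) (take q l) sg'])).
  + by rewrite /=; apply: le_ls.
  + by rewrite drop0 take0; split=> // x; rewrite /upd /= H1.
  + rewrite [ev _ _]/=  => q sg2 inp2 out2 lt_q same2 [-> -> H2].
    have {}lt_q : q < size l by [].
    rewrite (drop_nth 0 lt_q) cat_cons; set r := nth 0 l q.
    have lt_r : r < k by apply: (ls_lt l_ls); apply: mem_nth.
    apply: wp_seq; apply: wp_read; first by [].
      by apply: leq_trans (ltnW lt_r) (leq_trans (leq_addr _ _) L_le_B).
    apply: wp_store; first by apply: leq_trans le_L; rewrite expn_gt0.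
    split=> // x.
    have Ei : sg2 vi 0 = i by rewrite same2.
    have Ek2 : sg2 vk 0 = k by rewrite same2 //= /upd /= same1.
    rewrite /upd /= Ei Ek2 H2 (take_nth 0 lt_q) mem_rcons inE -/r size_t.
    case: (x =P i * k + r) => [->|Nx].
      by rewrite divnMDl ?modnMDl ?divn_small ?modn_small ?addn0 ?eqxx ?orbT //; lia.
    case: (x %/ k =P i) => //= Ex; case: (x %% k =P r) => //= Er.
    by case: Nx; rewrite (divn_eq x k) Ex Er.
  + move=> sg2 inp2 out2 same2; rewrite [ev _ _]/= => -[-> -> H2].
    rewrite [upd _ _ _ _ _ _]/upd /= in H2.
    rewrite drop_size; split=> // x.
    rewrite H2 (take_nth [::] lt_i) nth_rcons size_t size_rcons size_t take_size in_nil andbF orbF.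
    case: ltngtP => [lt_x|gt_x|Ex]; rewrite ?orbF //.
      by rewrite nth_default // size_t ltnW.
    by rewrite nth_default ?size_t ?Ex.
- move=> sg1 inp1 out1 same1; rewrite [ev _ _]/= Em drop_size take_size => -[-> -> H].
  exact: HQ.
Qed.

Lemma wp_add_completeness Q sg inp out : sg vk 0 = k ->
  (forall sg', same_outside (mods add_completeness) sg sg' ->
     (forall j, j < k -> sg' aCA j = j /\ sg' aCB j = j) -> Q sg' inp out) ->
  wp B add_completeness Q sg inp out.
Proof.
move=> Ek HQ; apply: (@wp_for _ _ _ _ (fun i sg' inp' out' =>
  [/\ inp' = inp, out' = out & forall j, j < i -> sg' aCA j = j /\ sg' aCB j = j])).
- by rewrite /= Ek; apply: leq_trans L_le_B; rewrite leq_addr.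
- by [].
- rewrite [ev _ _]/= Ek => i sg1 inp1 out1 lt_i same1 [-> -> H1].
  have le_i : i <= B by have := L_le_B; lia.
  apply: wp_seq; apply: wp_store => //; apply: wp_store => //; split=> // j.
  rewrite /upd /= ltnS leq_eqVlt; case: (j =P i) => [->|_] //= lt_j.
  exact: H1.
- by move=> sg1 inp1 out1 same1; rewrite [ev _ _]/= Ek => -[-> -> H]; apply: HQ.
Qed.

Lemma wp_read_constraint_word a w (Q : post) sg inp out : w <= B -> a \notin [:: vk; vj; vr] ->
  Q (upd (upd sg vr 0 w) a (sg vk 0 + sg vj 0) w) inp out ->
  wp B (read_constraint_word a) Q sg (w :: inp) out.
Proof.
by move=> le_w Na HQ; apply: wp_seq; apply: wp_read => //; apply: wp_store.
Qed.

Lemma wp_read_constraints Q sg out : sg vk 0 = k -> sg vn 0 = size cs ->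
  (forall j, j < k -> sg aCA j = j /\ sg aCB j = j) -> (forall j, sg aCT j = 0) ->
  (forall sg', same_outside (mods read_constraints) sg sg' ->
     (forall j, j < L ->
        [/\ sg' aCT j = (con j).1.1, sg' aCA j = (con j).1.2 & sg' aCB j = (con j).2]) ->
     Q sg' [::] out) ->
  wp B read_constraints Q sg (flatten [seq constraint_words c | c <- cs]) out.
Proof.
move=> Ek En EA ET HQ; apply: (@wp_for _ _ _ _ (fun i sg' inp' out' =>
  [/\ inp' = flatten [seq constraint_words c | c <- drop i cs], out' = out
    & forall j, j < k + i ->
        [/\ sg' aCT j = (con j).1.1, sg' aCA j = (con j).1.2 & sg' aCB j = (con j).2]])).
- by rewrite /= En; apply: leq_trans L_le_B; rewrite leq_addl.
- rewrite drop0; split=> // j; rewrite addn0 => lt_j.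
  by rewrite /con lt_j ET; have [-> ->] := EA _ lt_j.
- rewrite [ev _ _]/= En => i sg1 inp1 out1 lt_i same1 [-> -> H1].
  set c := nth (0, 0, 0) cs i.
  have Ec : con (k + i) = c by rewrite /con ltnNge leq_addr /= addKn.
  have lt_ki : k + i < L by rewrite ltn_add2l.
  have [le1 lt2 lt3] := con_bound cs_lt lt_ki; rewrite Ec in le1 lt2 lt3.
  have le_kB : k <= B by apply: leq_trans L_le_B; rewrite leq_addr.
  have Ek1 : sg1 vk 0 = k by rewrite same1.
  rewrite (drop_nth (0, 0, 0) lt_i) -/c map_cons /=.
  apply: wp_seq; apply: wp_read_constraint_word => //; first by apply: leq_trans le1 _; lia.
  apply: wp_seq; apply: wp_read_constraint_word => //; first by lia.
  apply: wp_read_constraint_word => //; first by lia.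
  split=> // j; rewrite /upd /= Ek1; case: (j =P k + i) => [->|Nj]; first by rewrite Ec.
  by rewrite addnS ltnS leq_eqVlt; case: eqP => //= _; apply: H1.
- by move=> sg1 inp1 out1 same1; rewrite [ev _ _]/= En drop_size => -[-> -> H]; apply: HQ.
Qed.

Lemma wp_powers Q sg inp out : sg vk 0 = k -> sg vn 0 = size cs ->
  (forall sg', same_outside (mods powers) sg sg' ->
     (forall j, j <= L -> sg' aP2 j = 2 ^ j) -> Q sg' inp out) ->
  wp B powers Q sg inp out.
Proof.
move=> Ek En HQ; apply: wp_seq; apply: wp_store.
  by apply: leq_trans le_L; rewrite expn_gt0.
apply: (@wp_for _ _ _ _ (fun i sg' inp' out' =>
  [/\ inp' = inp, out' = out & forall j, j <= i -> sg' aP2 j = 2 ^ j])).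
- by rewrite /upd /= Ek En L_le_B.
- by split=> // j; rewrite leqn0 => /eqP->; rewrite /upd.
- rewrite [ev _ _]/= [upd _ _ _ _ _ _]/upd /= Ek => i sg1 inp1 out1 lt_i same1 [-> -> H1].
  have {}lt_i : i < L by move: lt_i; rewrite /upd /= En.
  have Ei : sg1 aP2 i + sg1 aP2 i = 2 ^ i.+1 by rewrite H1 // addnn expnS mul2n.
  apply: wp_store.
    rewrite /upd /= Ei; apply: leq_trans le_L; exact: leq_pexp2l.
  split=> // j; rewrite /upd /= addn1 leq_eqVlt; case: (j =P i.+1) => [->|Nj] //= lt_j.
  exact: H1.
- move=> sg1 inp1 out1 same1; rewrite [ev _ _]/= /upd /= Ek En => -[-> -> H]; apply: HQ => //.
  apply: same_outside_trans (same_outside_upd _ _ _ _) (same_outside_sub _ same1) => //.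
  by move=> a; rewrite !inE => /orP[]->; rewrite ?orbT.
Qed.

Notation data := (data ls k cs).
Notation ok := (ok ls k cs).
Notation ok_rows := (ok_rows ls k cs).
Notation trans := (trans ls k cs).

Lemma pow_k_le_B : 2 ^ k <= B.
Proof. by apply: leq_trans le_L; rewrite leq_exp2l // leq_addr. Qed.

Lemma wp_setup (Q : post) :
  (forall sg, data sg -> Q sg [::] [::]) ->
  wp B setup Q (fun _ _ => 0) input_words [::].
Proof.
move=> HQ; have le_LB := L_le_B.
apply: wp_seq; apply: wp_read; [by []|exact: le_m|].
apply: wp_seq; apply: wp_read; [by []|by lia|].
apply: wp_seq; apply: wp_read; [by []|by lia|].
apply: wp_seq; apply: wp_read_base => // sg1 same1 H1.
apply: wp_seq; apply: wp_add_completeness => [|sg2 same2 H2].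
  by rewrite same1.
apply: wp_seq; apply: wp_read_constraints => // [|||sg3 same3 H3].
- by rewrite same2 // same1.
- by rewrite same2 // same1.
- by move=> j; rewrite same2 // same1.
apply: wp_powers => [||sg4 same4 H4].
- by rewrite same3 // same2 // same1.
- by rewrite same3 // same2 // same1.
apply: HQ; split.
- by rewrite same4 // same3 // same2 // same1.
- by rewrite same4 // same3 // same2 // same1.
- by rewrite same4 // same3 // same2 // same1.
- move=> i r lt_i lt_r; rewrite same4 // same3 // same2 // H1 in_nil andbF orbF.
  by rewrite divnMDl ?modnMDl ?divn_small ?modn_small ?addn0 //; lia.
- by move=> j lt_j; rewrite same4 //; have [] := H3 j lt_j.
- by move=> j lt_j; rewrite same4 //; have [] := H3 j lt_j.
- by move=> j lt_j; rewrite same4 //; have [] := H3 j lt_j.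
- exact: H4.
Qed.

Lemma ev_Not_holds sg e : ev sg (Not e) = holds sg (Not e).
Proof. by rewrite ev_not holds_not. Qed.

Lemma bool_le_B (b : bool) : b <= B.
Proof.
by apply: (@leq_trans 1); [case: b | apply: leq_trans le_L; rewrite expn_gt0].
Qed.

Lemma wp_first_row Q sg inp out : data sg ->
  (forall sg', same_outside (mods first_row) sg sg' -> ok_rows 1 sg' -> Q sg' inp out) ->
  wp B first_row Q sg inp out.
Proof.
move=> D HQ; apply: (@wp_for _ _ _ _ (fun i sg' inp' out' =>
  [/\ inp' = inp, out' = out & forall s, s < i -> sg' aOK s = ok 0 s])).
- by rewrite (ev_W D).
- by [].
- rewrite (ev_W D) => i sg1 inp1 out1 lt_i same1 [-> -> H1].
  have D1 : data (upd sg1 vs 0 i).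
    by apply: data_upd => //; apply: data_same same1 D.
  apply: wp_store; first by rewrite ev_Not_holds bool_le_B.
  set row := ev _ (All _ _ _).
  have Erow : row = ok 0 i.
    rewrite /row ev_Not_holds -/(All _ _ _) holds_all (ev_L D1); congr nat_of_bool.
    apply: eq_in_all => j; rewrite mem_iota /= add0n => lt_j.
    have D2 : data (upd (upd sg1 vs 0 i) vj 0 j) by apply: data_upd.
    rewrite holds_imp (holds_bit D2) //=; last exact: ltnW.
    by rewrite /holds /= (data_CT D2).
  split=> // s; rewrite /upd /= ltnS leq_eqVlt; case: (s =P i) => [->|_] //= lt_s.
  exact: H1.
- move=> sg1 inp1 out1 same1; rewrite (ev_W D) => -[-> -> H]; apply: HQ => //.
  by move=> [|//] s _ lt_s; rewrite mul0n H.
Qed.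

Lemma row_index_neq v v' s s' : v' < v -> s' < 2 ^ L ->
  (v' * 2 ^ L + s' == v * 2 ^ L + s) = false.
Proof.
move=> lt_v lt_s; apply/eqP => E.
have : v'.+1 * 2 ^ L <= v * 2 ^ L by rewrite leq_mul2r lt_v orbT.
by rewrite mulSn; lia.
Qed.

Lemma ok_rows_upd v sg a i x : a != aOK -> ok_rows v sg -> ok_rows v (upd sg a i x).
Proof.
by move=> Na H v' s lt_v lt_s; rewrite /upd eq_sym (negPf Na) /=; apply: H.
Qed.

Lemma ok_rows_same l v sg sg' : aOK \notin l -> same_outside l sg sg' ->
  ok_rows v sg -> ok_rows v sg'.
Proof. by move=> Nl same H v' s lt_v lt_s; rewrite same //; apply: H. Qed.

Lemma wp_next_rows Q sg inp out : data sg -> ok_rows 1 sg ->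
  (forall sg', same_outside (mods next_rows) sg sg' -> ok_rows m.+1 sg' ->
     Q sg' inp out) ->
  wp B next_rows Q sg inp out.
Proof.
move=> D ok1 HQ; apply: (@wp_for _ _ _ _ (fun v sg' inp' out' =>
  [/\ inp' = inp, out' = out & ok_rows v.+1 sg'])).
- by rewrite /= (data_m D).
- by [].
- rewrite [ev _ _]/= (data_m D) => v sg1 inp1 out1 lt_v same1 [-> -> ok_v].
  have D1 : data sg1 by apply: data_same same1 D.
  apply: wp_seq; apply: wp_store.
    by rewrite /= /upd /= (data_m D1); lia.
  set i := ev _ (Monus _ _); set sg2 := upd _ _ _ _.
  have Ei : i = m - 1 - v by rewrite /i /= /upd /= (data_m D1).
  have D2 : data sg2 by do 2!apply: data_upd => //.
  have ok2 : ok_rows v.+1 sg2 by do 2!apply: ok_rows_upd => //.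
  apply: (@wp_for _ _ _ _ (fun s sg' inp' out' => [/\ inp' = inp, out' = out,
    ok_rows v.+1 sg' & forall s', s' < s -> sg' aOK (v.+1 * 2 ^ L + s') = ok v.+1 s'])).
  + by rewrite (ev_W D2).
  + by [].
  + rewrite (ev_W D2) => s sg3 inp3 out3 lt_s same3 [-> -> ok3 H3].
    have D3 : data (upd sg3 vs 0 s) by apply: data_upd => //; apply: data_same same3 D2.
    have Ev3 : sg3 vv 0 = v by rewrite same3.
    have Ei3 : sg3 vi 0 = m - 1 - v by rewrite same3.
    apply: wp_store; first by rewrite ev_Not_holds bool_le_B.
    set row := ev _ (Plus _ _).
    have Erow : row = v.+1 * 2 ^ L + s.
      rewrite /row [LHS]/= -[upd _ _ _ _ aP2 _]/(ev (upd sg3 vs 0 s) W_expr) (ev_W D3).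
      by rewrite /upd /= Ev3 addn1.
    set val := ev _ (Not _).
    have Eval : val = ok v.+1 s.
      rewrite /val ev_Not_holds !holds_not negbK holds_sum (ev_K D3); congr nat_of_bool.
      apply: eq_in_has => S; rewrite mem_iota /= add0n => lt_S.
      have D4 : data (upd (upd sg3 vs 0 s) vS 0 S) by apply: data_upd.
      rewrite holds_sum (ev_W D4).
      apply: eq_in_has => t; rewrite mem_iota /= add0n => lt_t.
      rewrite (@holds_step ls k cs cs_lt) //.
      * by rewrite /upd /= Ei3 Ev3.
      * exact: data_upd.
      * by rewrite /upd /= Ei3; lia.
      * by do 3!apply: ok_rows_upd => //; rewrite /upd /= Ev3.
    rewrite Erow Eval; split=> // [v' s' lt_v' lt_s'|s' lt_s'].
      by rewrite /upd /= row_index_neq //; apply: ok3.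
    rewrite /upd eqxx eqn_add2l /=; case: (s' =P s) => [->|Ns] //.
    by apply: H3; move/eqP: Ns; lia.
  + move=> sg3 inp3 out3 same3; rewrite (ev_W D2) => -[-> -> ok3 H3]; split=> //.
    move=> v' s; rewrite ltnS leq_eqVlt; case: eqP => [-> _|_ lt_v'] lt_s; first exact: H3.
    exact: ok3.
- by move=> sg1 inp1 out1 same1; rewrite [ev _ _]/= (data_m D) => -[-> -> H]; apply: HQ.
Qed.

Lemma wp_find_step (Q : post) sg inp out i s : data sg ->
  i < m -> sg vi 0 = i -> sg vv 0 = m - 1 - i -> sg vs 0 = s ->
  ok_rows m.+1 sg -> ok (m - i) s ->
  (forall sg', same_outside (mods find_step) sg sg' -> sg' vbt 0 < 2 ^ L ->
     trans i (sg' vbS 0) s (sg' vbt 0) -> ok (m - 1 - i) (sg' vbt 0) -> Q sg' inp out) ->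
  wp B find_step Q sg inp out.
Proof.
move=> D lt_i Ei Ev Es okm oks HQ.
pose P S t := trans i S s t && ok (m - 1 - i) t.
(* Both loops maintain that a pair has been found or that every pair tried so far fails. A later
   success overwrites the pair by another valid one. *)
pose found (sg' : store) := sg' vbt 0 < 2 ^ L /\ P (sg' vbS 0) (sg' vbt 0).
apply: (@wp_for _ _ _ _ (fun S sg' inp' out' => [/\ inp' = inp, out' = out
  & found sg' \/ forall S' t, S' < S -> t < 2 ^ L -> ~~ P S' t])).
- by rewrite (ev_K D) pow_k_le_B.
- by split=> //; right.
- rewrite (ev_K D) => S sg1 inp1 out1 lt_S same1 [-> -> H1].
  have D1 : data (upd sg1 vS 0 S) by apply: data_upd => //; apply: data_same same1 D.
  apply: (@wp_for _ _ _ _ (fun t sg' inp' out' => [/\ inp' = inp, out' = out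
    & found sg' \/ forall S' t', (S' < S) || (S' == S) && (t' < t) ->
      t' < 2 ^ L -> ~~ P S' t'])).
  + by rewrite (ev_W D1).
  + split=> //; case: H1 => [[H1 H1']|H1]; [by left|right].
    by move=> S' t' /orP[|/andP[]//] lt_S'; apply: H1.
  + rewrite (ev_W D1) => t sg2 inp2 out2 lt_t same2 [-> -> H2].
    have D2 : data (upd sg2 vt 0 t) by apply: data_upd => //; apply: data_same same2 D1.
    have Ei2 : sg2 vi 0 = i by rewrite same2 //= /upd /= same1.
    have Ev2 : sg2 vv 0 = m - 1 - i by rewrite same2 //= /upd /= same1.
    have Es2 : sg2 vs 0 = s by rewrite same2 //= /upd /= same1.
    have ES2 : sg2 vS 0 = S by rewrite same2.
    have ok2 : ok_rows m.+1 sg2.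
      apply: ok_rows_same same2 _ => //; apply: ok_rows_upd => //.
      exact: ok_rows_same same1 okm.
    have Estep : holds (upd sg2 vt 0 t) step_expr = P S t.
      rewrite (@holds_step ls k cs cs_lt) //.
      * by rewrite /upd /= Ei2 Ev2 Es2 ES2.
      * by rewrite /upd /= Ei2.
      * move=> v' s' lt_v' lt_s'; rewrite /upd /= ok2 //.
        by move: lt_v'; rewrite /upd /= Ev2; lia.
    apply: wp_if => [Hstep|/eqP Hstep].
      apply: wp_seq; apply: wp_store.
        rewrite /= /upd /= ES2; apply: leq_trans pow_k_le_B; exact: ltnW.
      apply: wp_store; first by rewrite /= /upd /=; apply: leq_trans le_L; apply: ltnW.
      split=> //; left; split; rewrite /upd /= //.
      by rewrite ES2 -Estep.
    split=> //; case: H2 => [[H2 H2']|H2]; [by left|right].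
    move=> S' t'; rewrite ltnS [t' <= t]leq_eqVlt.
    case: (S' =P S) => [->|_]; last by rewrite orbF => lt_S'; apply: H2; rewrite lt_S'.
    case: (t' =P t) => [-> _ _|_]; first by rewrite -Estep /holds Hstep.
    by move=> Ht; apply: H2; rewrite eqxx.
  + move=> sg2 inp2 out2 same2; rewrite (ev_W D1) => -[-> -> H2]; split=> //.
    case: H2 => [H2|H2]; [by left|right] => S' t'; rewrite ltnS leq_eqVlt => HS lt_t.
    by apply: H2 => //; rewrite lt_t andbT orbC.
- move=> sg1 inp1 out1 same1; rewrite (ev_K D) => -[-> -> [[lt_t /andP[H1 H1']]|H1]].
    exact: HQ.
  (* The recurrence for [ok] provides a valid pair, so the search cannot have failed throughout. *)
  have [S lt_S [t lt_t HP]] := ok_step lt_i oks.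
  by have := H1 S t lt_S lt_t; rewrite /P HP.
Qed.

Lemma wp_write_user (Q : post) sg inp out : data sg ->
  (forall sg', same_outside (mods write_user) sg sg' ->
     Q sg' inp (out ++ size (used k (bit (sg vbS 0))) :: used k (bit (sg vbS 0)))) ->
  wp B write_user Q sg inp out.
Proof.
move=> D HQ.
have Ebit r : r < k -> ev (upd sg vr 0 r) (Bit (Var vbS) (Var vr)) = bit (sg vbS 0) r.
  move=> lt_r; rewrite ev_bit //=.
  by rewrite /upd /= (data_P2 D) //; lia.
apply: wp_seq; apply: wp_write.
have -> : ev sg (Sum vr (Var vk) (Bit (Var vbS) (Var vr))) = size (used k (bit (sg vbS 0))).
  rewrite [LHS]/= (data_k D) size_filter -sum_pred.
  by apply: eq_big_seq => r; rewrite mem_iota /= => lt_r; apply: Ebit.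
set n := size _.
apply: (@wp_for _ _ _ _ (fun i sg' inp' out' => [/\ inp' = inp
  & out' = rcons out n ++ [seq r <- iota 0 i | bit (sg vbS 0) r]])).
- by rewrite /= (data_k D); have := L_le_B; lia.
- by rewrite cats0.
- rewrite [ev _ _]/= (data_k D) => r sg1 inp1 out1 lt_r same1 [-> ->].
  have D1 : data sg1 by apply: data_same same1 D.
  have Eb : ev (upd sg1 vr 0 r) (Bit (Var vbS) (Var vr)) = bit (sg vbS 0) r.
    by rewrite ev_bit //= /upd /= ?same1 // ?(data_P2 D) //; lia.
  apply: wp_if; rewrite Eb => Hb.
    apply: wp_write; split=> //.
    rewrite -[r.+1]addn1 iotaD filter_cat /= add0n; case: (bit _ r) Hb => // _.
    by rewrite -cats1 -catA.
  split=> //; rewrite -[r.+1]addn1 iotaD filter_cat /= add0n.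
  by case: (bit _ r) Hb => // _; rewrite cats0.
- move=> sg1 inp1 out1 same1; rewrite [ev _ _]/= (data_k D) => -[-> ->].
  rewrite cat_rcons; exact: HQ.
Qed.

Lemma wp_write_solution (Q : post) sg inp out : data sg -> ok_rows m.+1 sg ->
  ok m (all_needed k cs) ->
  (forall sg' S, same_outside (mods write_solution) sg sg' -> solution ls k cs S ->
     Q sg' inp (rcons out 1 ++ encode_users k m S)) ->
  wp B write_solution Q sg inp out.
Proof.
move=> D okm okall HQ; apply: wp_seq; apply: wp_write; apply: wp_seq; apply: wp_store.
  by rewrite [ev _ _]/= -[sg aP2 _]/(ev sg W_expr) (ev_W D); apply: leq_trans le_L; lia.
have -> : ev sg (Monus W_expr (Cst 1)) = all_needed k cs.
  by rewrite [ev _ _]/= -[sg aP2 _]/(ev sg W_expr) (ev_W D).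
set sg0 := upd _ _ _ _.
have D0 : data sg0 by apply: data_upd.
(* The function [f] is existentially quantified because the sets chosen for earlier users are no
   longer in the store; only their encoding in the output remains. *)
apply: (@wp_for _ _ _ _ (fun i sg' inp' out' => [/\ inp' = inp, sg' vs 0 < 2 ^ L &
  exists2 f, partial ls k cs f i (sg' vs 0)
    & out' = rcons out 1 ++ encode_users k i (fun i' => bit (f i'))])).
- by rewrite /= (data_m D0).
- split=> //; first by rewrite /= /sg0 /upd /= /all_needed subn1 prednK ?expn_gt0.
  exists (fun=> 0); last by rewrite cats0.
  by apply: partial0 => // j; apply: bit_all_needed.
- rewrite [ev _ _]/= (data_m D0) => i sg1 inp1 out1 lt_i same1 [-> lt_s [f Pf ->]].
  have D1 : data sg1 by apply: data_same same1 D0.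
  have ok1 : ok_rows m.+1 sg1.
    by apply: ok_rows_same same1 _ => //; apply: ok_rows_upd.
  have [_ _ oks] := Pf.
  apply: wp_seq; apply: wp_store.
    by rewrite /= /upd /= (data_m D1); lia.
  set v := ev _ (Monus _ _); have Ev : v = m - 1 - i by rewrite /v /= /upd /= (data_m D1).
  set sg2 := upd _ _ _ _.
  have D2 : data sg2 by do 2!apply: data_upd => //.
  apply: wp_seq; apply: (wp_find_step D2 lt_i (s := sg1 vs 0)) => //.
  move=> sg3 same3 lt_t3 tr3 ok3.
  have D3 : data sg3 by apply: data_same same3 D2.
  apply: wp_seq; apply: wp_write_user => // sg4 same4.
  have Et4 : sg4 vbt 0 = sg3 vbt 0 by rewrite same4.
  apply: wp_store; first by rewrite /= Et4; apply: leq_trans (ltnW lt_t3) le_L.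
  have Et : ev sg4 (Var vbt) = sg3 vbt 0 := Et4.
  rewrite Et; split=> //.
  exists (fun x => if x == i then sg3 vbS 0 else f x).
    by apply: partial_step Pf tr3 ok3.
  rewrite -catA; congr (_ ++ _); rewrite /encode_users -[i.+1]addn1 iotaD map_cat flatten_cat.
  congr (_ ++ _).
    congr flatten; apply/eq_in_map => i'; rewrite mem_iota /= add0n => lt_i'.
    by rewrite (ltn_eqF lt_i').
  by rewrite /= add0n eqxx cats0.
- move=> sg1 inp1 out1 same1; rewrite [ev _ _]/= (data_m D0) => -[-> _ [f Pf ->]].
  apply: HQ; last exact: partial_solution Pf.
  apply: same_outside_trans (same_outside_upd _ _ _ _) (same_outside_sub _ same1) => //.
  by move=> a Ha; rewrite -[mods write_solution]/(vs :: vi :: _) inE Ha orbT.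
Qed.

Lemma apep_cmd_correct :
  wp B apep_cmd (fun _ _ out => correct_output ls k cs out)
    (fun _ _ => 0) input_words [::].
Proof.
apply: wp_seq; apply: wp_setup => sg1 D1.
apply: wp_seq; apply: (wp_first_row D1) => sg2 same2 ok2.
have D2 : data sg2 by apply: data_same same2 D1.
apply: wp_seq; apply: (wp_next_rows D2 ok2) => sg3 same3 ok3.
have D3 : data sg3 by apply: data_same same3 D2.
have Eok sg : data sg -> ok_rows m.+1 sg -> holds sg solvable_expr = ok m (all_needed k cs).
  move=> D okm; rewrite /holds [ev _ _]/= -[sg aP2 _]/(ev sg W_expr) (ev_W D) (data_m D).
  rewrite okm ?eqb0 ?negbK // ltn_subrL expn_gt0 //.
apply: wp_seq; apply: wp_if => [|/eqP]; rewrite -?[_ != 0]/(holds _ _) => H.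
  rewrite Eok // in H; apply: wp_write_solution => // sg4 S same4 HS.
  have D4 : data sg4 by apply: data_same same4 D3.
  have ok4 : ok_rows m.+1 sg4 by apply: ok_rows_same same4 ok3.
  apply: wp_if; rewrite ev_not Eok // H // => _.
  by left; exists S.
apply: wp_if; rewrite ev_not {1}/holds H // => _.
apply: wp_write; right; split=> // -[S HS].
have := Eok _ D3 ok3; rewrite {1}/holds H => /esym/negP; apply.
have [_ Sbod _] := HS.
(* For [v = m] the last [v] users are all users, so a solution would make the tested entry true. *)
apply: (ok_solution _ HS) => // [c /cs_lt[]//|j lt_j _ Ej].
by have [i lt_i Hi] := Sbod j lt_j Ej; exists i; rewrite ?subnn.
Qed.

End Correctness.

(** * Instances as lists of numbers *)

Definition rank (T : finType) (x : T) : nat := enum_rank x.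

Lemma rank_lt (T : finType) (x : T) : rank x < #|T|.
Proof. exact: ltn_ord. Qed.

Lemma rank_inj (T : finType) : injective (@rank T).
Proof. by move=> x y /val_inj/enum_rank_inj. Qed.

Lemma rank_surj (T : finType) i : i < #|T| -> exists x : T, rank x = i.
Proof. by move=> lt_i; exists (enum_val (Ordinal lt_i)); rewrite /rank enum_valK. Qed.

Lemma map_rank_enum (T : finType) : [seq rank x | x <- enum T] = iota 0 #|T|.
Proof.
apply: (@eq_from_nth _ 0); rewrite size_map -cardE ?size_iota // => i lt_i.
have [x <-] := rank_surj lt_i.
by rewrite (nth_map x) -?cardE ?rank_lt // nth_enum_rank nth_iota ?rank_lt.
Qed.

Section Bridge.

Variables (U R : finType) (I : instance U R).

Definition rank_seq (S : {set R}) := [seq rank r | r <- enum S].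
Definition constr_code (c : constr R) :=
  match c with
  | BoD_E a b => (0, rank a, rank b)
  | SoD_U a b => (1, rank a, rank b)
  end.

Definition base_lists := [seq rank_seq [set r | (u, r) \in base I] | u <- enum U].
Definition constraint_codes := [seq constr_code c | c <- enum (constraints I)].

Notation ls := base_lists.
Notation cs := constraint_codes.
Notation k := #|R|.

Lemma size_base_lists : size ls = #|U|.
Proof. by rewrite size_map -cardE. Qed.

Lemma encode_instance_words : encode_instance I = input_words ls k cs.
Proof.
rewrite /encode_instance /input_words size_base_lists size_map -cardE.
rewrite /encode_relation /base_lists /constraint_codes -!map_comp.
congr (_ ++ (flatten _ ++ flatten _)); apply: eq_map => x /=.
  by rewrite /encode_resources /list_words /rank_seq size_map -cardE.
by case: x.
Qed.

Lemma mem_rank_seq S r : (rank r \in rank_seq S) = (r \in S).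
Proof. by rewrite mem_map ?mem_enum //; apply: rank_inj. Qed.

Lemma base_lists_lt l r : l \in ls -> r \in l -> r < k.
Proof. by move=> /mapP[u _ ->] /mapP[x _ ->]; apply: rank_lt. Qed.

Lemma size_in_base_lists l : l \in ls -> size l <= k.
Proof. by move=> /mapP[u _ ->]; rewrite size_map -cardE max_card. Qed.

Lemma nth_base_lists u : nth [::] ls (rank u) = rank_seq [set r | (u, r) \in base I].
Proof. by rewrite (nth_map u) -?cardE ?rank_lt // nth_enum_rank. Qed.

Lemma constraint_codes_lt c : c \in cs -> [/\ c.1.1 <= 1, c.1.2 < k & c.2 < k].
Proof. by move=> /mapP[[a b|a b] _ ->]; split=> //; apply: rank_lt. Qed.

Lemma con_rank (r : R) : con k cs (rank r) = (0, rank r, rank r).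
Proof. by rewrite /con rank_lt. Qed.

Lemma con_codeP c : c \in constraints I ->
  exists2 j, j < k + size cs & con k cs j = constr_code c.
Proof.
move=> Ic; have /(nthP (0, 0, 0))[j lt_j Ej] : constr_code c \in cs.
  by apply: map_f; rewrite mem_enum.
by exists (k + j); rewrite ?ltn_add2l // /con ltnNge leq_addr /= addKn.
Qed.

Lemma con_cases j : j < k + size cs ->
  (exists r : R, con k cs j = (0, rank r, rank r)) \/
  (exists2 c, c \in constraints I & con k cs j = constr_code c).
Proof.
move=> lt_j; case: (ltnP j k) => [/rank_surj[r <-]|le_j].
  by left; exists r; apply: con_rank.
have : con k cs j \in cs.
  by rewrite /con ltnNge le_j /=; apply: mem_nth; rewrite ltn_subLR.
by move=> /mapP[c]; rewrite mem_enum => Ic Ej; right; exists c.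
Qed.

Lemma users_ofI_neq0 (A : {set U * R}) r r' :
  (users_of A r :&: users_of A r' != set0)
  = [exists u, ((u, r) \in A) && ((u, r') \in A)].
Proof.
apply/set0Pn/existsP => -[u]; first by rewrite !inE; exists u.
by move=> Hu; exists u; rewrite !inE.
Qed.

(** The constraints with index below [k] express completeness, the others eligibility. Only the
    values of [S] at ranks are prescribed; [solution] looks at no others. *)
Lemma solution_valid (A : {set U * R}) S :
  (forall u r, S (rank u) (rank r) = ((u, r) \in A)) ->
  solution ls k cs S <-> valid I A.
Proof.
rewrite /solution size_base_lists => ES; split=> [[Sbase Sbod Ssod]|/and3P[Abase Acomp Ael]].
  apply/and3P; split.
  - apply/subsetP => -[u r]; rewrite -ES => Sur.
    have := Sbase _ _ (rank_lt u) (rank_lt r) Sur.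
    by rewrite nth_base_lists mem_rank_seq inE.
  - apply/forallP => r; have [] := Sbod (rank r) _ _; rewrite ?con_rank //.
      exact: leq_trans (rank_lt r) (leq_addr _ _).
    move=> i /rank_surj[u <-] /andP[Sur _]; apply/set0Pn; exists u.
    by rewrite inE -ES.
  - apply/forall_inP => c /con_codeP[j lt_j Ej]; move: (Sbod j lt_j) (Ssod j).
    rewrite Ej; case: c {Ej} => a b /=.
      move=> /(_ erefl)[i /rank_surj[u <-]]; rewrite !ES => Hu _.
      by rewrite users_ofI_neq0; apply/existsP; exists u.
    move=> _ H; rewrite -[_ == _]negbK users_ofI_neq0; apply/existsPn => u.
    by rewrite -!ES H ?rank_lt.
split.
- move=> _ _ /rank_surj[u <-] /rank_surj[r <-]; rewrite ES => /(subsetP Abase) Hur.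
  by rewrite nth_base_lists mem_rank_seq inE.
- move=> j /con_cases[[r ->] _|[c Ic ->]] /=.
    have /set0Pn[u] := forallP Acomp r; rewrite inE => Aur.
    by exists (rank u); rewrite ?rank_lt // ES Aur.
  have := forall_inP Ael c Ic; case: c {Ic} => a b //=.
  rewrite users_ofI_neq0 => /existsP[u Hu] _.
  by exists (rank u); rewrite ?rank_lt // !ES.
move=> j _ /con_cases[[r ->] //|[c Ic ->]] + /rank_surj[u <-].
have := forall_inP Ael c Ic; case: c {Ic} => a b //=.
by rewrite -[_ == _]negbK users_ofI_neq0 => /existsPn/(_ u) + _; rewrite !ES.
Qed.

Lemma encode_relation_users (A : {set U * R}) S :
  (forall u r, S (rank u) (rank r) = ((u, r) \in A)) ->
  encode_users k #|U| S = encode_relation A.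
Proof.
move=> ES; rewrite /encode_users /encode_relation -map_rank_enum -map_comp.
congr flatten; apply: eq_map => u /=.
have -> : used k (S (rank u)) = rank_seq [set r | (u, r) \in A].
  rewrite /used -map_rank_enum filter_map /rank_seq; congr map.
  rewrite {2}/enum_mem enumT; apply: eq_filter => r /=.
  by rewrite ES inE.
by rewrite /encode_resources size_map -cardE.
Qed.

Lemma correct_output_answer y : correct_output ls k cs y -> correct_answer I y.
Proof.
case=> [[S HS ->]|[noS ->]].
  left; exists [set p | S (rank p.1) (rank p.2)].
    by apply/(solution_valid (S := S)) => // u r; rewrite inE.
  by rewrite size_base_lists (@encode_relation_users [set p | S (rank p.1) (rank p.2)]) // => u r; rewrite inE.
right; split=> // A; apply/negP => vA; apply: noS.
(* Quantifying over the pairs of [A] avoids inverting [rank] at numbers out of range. *)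
exists (fun i j => [exists p in A, (rank p.1 == i) && (rank p.2 == j)]).
apply/(solution_valid (A := A)) => // u r.
apply/exists_inP/idP => [[[u' r'] Ap /andP[/eqP Eu /eqP Er]]|Aur].
  by rewrite -(rank_inj Eu) -(rank_inj Er).
by exists (u, r); rewrite ?eqxx.
Qed.

(** Each of the two types contributes at most one constraint per ordered pair of resources. Hence
    the number of states is bounded in terms of [k] alone. *)
Lemma card_constraints : size cs <= 2 * k ^ 2.
Proof.
rewrite size_map -cardE; apply: leq_trans (max_card _) _.
apply: leq_trans (leq_card _ (can_inj (@constr_to_sumK R))) _.
by rewrite card_sum card_prod mul2n -addnn mulnn.
Qed.

End Bridge.

(** * The time bound *)

Lemma size_flatten_words s : size s <= size (flatten [seq list_words l | l <- s]).
Proof. by elim: s => //= l s IHs; rewrite size_cat; lia. Qed.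

Lemma exp_square_absorb D k :
  2 ^ (D * k ^ 2) <= 2 ^ (D * 2 ^ D) * (k ^ 2) ^ (k ^ 2).
Proof.
case: (leqP (2 ^ D) (k ^ 2)) => [le_k|/ltnW le_k].
  rewrite expnM; apply: leq_trans (leq_pmull _ _); last by rewrite expn_gt0.
  by case: (k ^ 2) le_k => // n le_n; rewrite leq_exp2r.
(* For [k = 0] the second factor is [0 ^ 0 = 1], hence still positive. *)
apply: leq_trans (leq_pmulr _ _); last by case: k {le_k} => // k; rewrite !expn_gt0.
by rewrite leq_exp2l // leq_mul2l le_k orbT.
Qed.

Local Open Scope ring_scope.

(** The identity [2 ^ (x log x) = x ^ x] at [x = k ^ 2]. For [k = 0] the first factor makes the
    exponent 0, and both sides are 1. *)
Lemma powR_log2_square (K : realType) (k : nat) :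
  (2 : K) `^ (k%:R ^+ 2 * log2 (k%:R ^+ 2)) = ((k ^ 2) ^ (k ^ 2))%:R.
Proof.
case: k => [|k]; first by rewrite expr0n /= mul0r powRr0.
set x : K := k.+1%:R ^+ 2.
have x_gt0 : 0 < x by rewrite exprn_gt0 // ltr0n.
have ln2 : ln (2 : K) != 0 by rewrite gt_eqF // ln_gt0 // ltr1n.
rewrite natrX -powR_mulrn ?ler0n // natrX -/x /powR (gt_eqF x_gt0) pnatr_eq0 /=.
by rewrite /log2 mulrA divfK.
Qed.

Theorem theorem15 (K : realType) :
  solvable_in_time_Ostar
    (fun k : nat => (2 : K) `^ (k%:R ^+ 2 * log2 (k%:R ^+ 2))).
Proof.
have [T [D HT] run] := cmd_program wf_apep_cmd.
(* The first factor of the constant comes from [B + 2 <= 2 * B] raised to the power [D], the second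
   from [exp_square_absorb] at [3 * D]. *)
exists (ccmd nvars apep_cmd 0 0), (2 ^ D * 2 ^ (3 * D * 2 ^ (3 * D)))%N, D => U R I.
set ls := base_lists I; set cs := constraint_codes I; set k := #|R|.
set N := size (encode_instance I).
pose B := (N * 2 ^ (3 * k ^ 2))%N.
have le_L : (2 ^ (k + size cs) <= B)%N.
  apply: (@leq_trans (2 ^ (3 * k ^ 2))%N); last by rewrite leq_pmull.
  have := card_constraints I; rewrite leq_exp2l // -/cs -/k => le_cs.
  by have : (k <= k ^ 2)%N; [rewrite -mulnn; nia | lia].
have le_m : (size ls <= B)%N.
  apply: (@leq_trans N); last by rewrite leq_pmulr // expn_gt0.
  rewrite /N encode_instance_words /input_words !size_cat.
  have := size_flatten_words ls; rewrite /ls; lia.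
have le_ls l : l \in ls -> (size l <= B)%N.
  move=> /size_in_base_lists le_l; apply: leq_trans le_l _.
  apply: leq_trans (ltnW (ltn_expl k (ltnSn 1))) (leq_trans _ le_L).
  by rewrite leq_exp2l // leq_addr.
have := apep_cmd_correct (@base_lists_lt _ _ I) (@constraint_codes_lt _ _ I) le_m le_ls le_L.
rewrite -encode_instance_words => /run[t [y [le_t comp Hy]]].
exists t, y; split=> //; first exact: correct_output_answer.
rewrite powR_log2_square -natrX -!natrM ler_nat.
apply: leq_trans le_t (leq_trans (HT B) _).
(* The three header words give [N >= 3], hence [2 <= B] and [B + 2 <= 2 * B]. *)
have N_gt2 : (2 < N)%N by rewrite /N /encode_instance size_cat.
apply: (@leq_trans ((2 * B) ^ D)%N).
  case: (D) => // n; rewrite leq_exp2r // mul2n -addnn leq_add2l.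
  by rewrite /B; apply: leq_trans (ltnW N_gt2) (leq_pmulr _ _); rewrite expn_gt0.
rewrite [((2 * B) ^ D)%N]expnMn /B [((N * _) ^ D)%N]expnMn -expnM mulnAC.
have := exp_square_absorb (3 * D) k; rewrite mulnAC.
move: ((k ^ 2) ^ (k ^ 2))%N (2 ^ (3 * k ^ 2 * D))%N (2 ^ (3 * D * 2 ^ (3 * D)))%N => G X C HX.
rewrite -!mulnA leq_mul2l [(C * (_ * _))%N]mulnCA leq_mul2l.
by rewrite HX !orbT.
Qed.
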